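(* Let $E$ be a Fréchet locally convex space which does not contain a copy of $\ell_1$ and which satisfies the density condition. Then the following are equivalent: (a) $E$ is a weakly $\aleph$-space; (b) $E$ is a weakly $\aleph_0$-space; (c) the strong dual $E'$ of $E$ is separable.
   Context: A Fréchet lcs is a metrizable complete locally convex space. $E$ satisfies the density condition if every bounded subset of the strong dual $E'$ (with topology $\beta(E',E)$) is metrizable. A $k$-network in $Y$ is a family $\mathcal N$ of subsets such that whenever $K\subset U$ with $K$ compact and $U$ open, there is a finite $\mathcal F\subset\mathcal N$ with $K\subset\bigcup\mathcal F\subset U$. An $\aleph_0$-space (resp. $\aleph$-space) is a regular space with a countable (resp. $\sigma$-locally finite) $k$-network. $E$ is a weakly $\aleph$-space (resp. weakly $\aleph_0$-space) if $(E,\sigma(E,E'))$ is an $\aleph$-space (resp. $\aleph_0$-space). *)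

(* Defs.v *)
From Stdlib Require Import Reals List.
Open Scope R_scope.

Section Topo.
Variable X : Type.
Variable open : (X -> Prop) -> Prop.

Definition closed (C : X -> Prop) : Prop := open (fun x => ~ C x).

Definition regular_space : Prop :=
  (forall x : X, closed (fun y => y = x)) /\
  (forall (C : X -> Prop) (x : X), closed C -> ~ C x ->
     exists U V, open U /\ open V /\ U x /\ (forall y, C y -> V y) /\
                 (forall y, ~ (U y /\ V y))).

Definition compact (K : X -> Prop) : Prop :=
  forall (cov : (X -> Prop) -> Prop),
    (forall U, cov U -> open U) ->
    (forall x, K x -> exists U, cov U /\ U x) ->
    exists L : list (X -> Prop),
      (forall U, In U L -> cov U) /\ (forall x, K x -> exists U, In U L /\ U x).

Definition k_network (N : (X -> Prop) -> Prop) : Prop :=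
  forall K U : X -> Prop, compact K -> open U -> (forall x, K x -> U x) ->
    exists F : list (X -> Prop),
      (forall S, In S F -> N S) /\
      (forall x, K x -> exists S, In S F /\ S x) /\
      (forall S, In S F -> forall x, S x -> U x).

Definition countable_family (N : (X -> Prop) -> Prop) : Prop :=
  exists g : nat -> (X -> Prop), forall S, N S -> exists n, g n = S.

Definition locally_finite (N : (X -> Prop) -> Prop) : Prop :=
  forall x : X, exists W, open W /\ W x /\
    exists L : list (X -> Prop),
      forall S, N S -> (exists y, W y /\ S y) -> In S L.

Definition sigma_locally_finite (N : (X -> Prop) -> Prop) : Prop :=
  exists Nk : nat -> ((X -> Prop) -> Prop),
    (forall k, locally_finite (Nk k)) /\ (forall S, N S <-> exists k, Nk k S).

Definition aleph0_space : Prop :=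
  regular_space /\ exists N, k_network N /\ countable_family N.

Definition aleph_space : Prop :=
  regular_space /\ exists N, k_network N /\ sigma_locally_finite N.

Definition separable : Prop :=
  exists s : nat -> X, forall U, open U -> (exists x, U x) -> exists n, U (s n).

Definition metrizable_subset (A : X -> Prop) : Prop :=
  exists d : X -> X -> R,
    (forall x y, A x -> A y -> 0 <= d x y) /\
    (forall x y, A x -> A y -> (d x y = 0 <-> x = y)) /\
    (forall x y, A x -> A y -> d x y = d y x) /\
    (forall x y z, A x -> A y -> A z -> d x z <= d x y + d y z) /\
    (forall S : X -> Prop, (forall x, S x -> A x) ->
       ((exists U, open U /\ forall x, A x -> (S x <-> U x)) <->
        (forall x, S x -> exists r, 0 < r /\
                     forall y, A y -> d x y < r -> S y))).
End Topo.

(* ---------- Fréchet spaces (real scalars) ---------------------------------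
   A Fréchet lcs: a real vector space whose (Hausdorff, metrizable, locally
   convex) topology is given by a countable family of seminorms, complete. *)
Record Frechet := {
  vT :> Type;
  v0 : vT;
  vadd : vT -> vT -> vT;
  vopp : vT -> vT;
  vscal : R -> vT -> vT;
  vaddA : forall x y z, vadd x (vadd y z) = vadd (vadd x y) z;
  vaddC : forall x y, vadd x y = vadd y x;
  vadd0 : forall x, vadd x v0 = x;
  vaddN : forall x, vadd x (vopp x) = v0;
  vscal1 : forall x, vscal 1 x = x;
  vscalA : forall a b x, vscal a (vscal b x) = vscal (a * b) x;
  vscalDr : forall a x y, vscal a (vadd x y) = vadd (vscal a x) (vscal a y);
  vscalDl : forall a b x, vscal (a + b) x = vadd (vscal a x) (vscal b x);
  sem : nat -> vT -> R;
  sem_triangle : forall n x y, sem n (vadd x y) <= sem n x + sem n y;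
  sem_homog : forall n a x, sem n (vscal a x) = Rabs a * sem n x;
  sem_separating : forall x, (forall n, sem n x = 0) -> x = v0;
  complete : forall u : nat -> vT,
    (forall n eps, 0 < eps -> exists N, forall i j, (N <= i)%nat -> (N <= j)%nat ->
        sem n (vadd (u i) (vopp (u j))) < eps) ->
    exists l, forall n eps, 0 < eps -> exists N, forall i, (N <= i)%nat ->
        sem n (vadd (u i) (vopp l)) < eps
}.

Section FrechetDefs.
Variable E : Frechet.

Definition vsub (x y : E) : E := vadd E x (vopp E y).

Fixpoint maxsem (n : nat) (x : E) : R :=
  match n with
  | O => sem E O x
  | S m => Rmax (maxsem m x) (sem E (S m) x)
  end.

Definition E_open (U : E -> Prop) : Prop :=
  forall x, U x -> exists n eps, 0 < eps /\
    forall y, maxsem n (vsub y x) < eps -> U y.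

Definition is_linear (f : E -> R) : Prop :=
  (forall x y, f (vadd E x y) = f x + f y) /\
  (forall a x, f (vscal E a x) = a * f x).

Definition dual : Type :=
  { f : E -> R | is_linear f /\ exists n C, forall x, Rabs (f x) <= C * maxsem n x }.

Definition ev (f : dual) (x : E) : R := proj1_sig f x.

Definition E_bounded (B : E -> Prop) : Prop :=
  forall n, exists M, forall x, B x -> sem E n x <= M.

Definition strong_open (U : dual -> Prop) : Prop :=
  forall f, U f -> exists B eps, E_bounded B /\ 0 < eps /\
    forall g, (forall x, B x -> Rabs (ev g x - ev f x) <= eps) -> U g.

Definition strong_bounded (A : dual -> Prop) : Prop :=
  forall B, E_bounded B -> exists M, forall f x, A f -> B x -> Rabs (ev f x) <= M.

Definition density_condition : Prop :=
  forall A, strong_bounded A -> metrizable_subset dual strong_open A.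

Definition weak_open (U : E -> Prop) : Prop :=
  forall x, U x -> exists (L : list dual) eps, 0 < eps /\
    forall y, (forall f, In f L -> Rabs (ev f (vsub y x)) < eps) -> U y.

Definition weakly_aleph_space : Prop := aleph_space E weak_open.
Definition weakly_aleph0_space : Prop := aleph0_space E weak_open.

Definition strong_dual_separable : Prop := separable dual strong_open.

(* E contains a copy of l1: a linear topological isomorphism of l1 onto a
   subspace of E.  Elements of l1 are absolutely summable real sequences,
   ||a||_1 = l where infinite_sum (|a_n|) l. *)
Definition summable (a : nat -> R) : Prop :=
  exists l, infinite_sum (fun n => Rabs (a n)) l.

Definition contains_l1 : Prop :=
  exists T : (nat -> R) -> E,
    (forall a b, summable a -> summable b ->
       T (fun n => a n + b n) = vadd E (T a) (T b)) /\
    (forall r a, summable a -> T (fun n => r * a n) = vscal E r (T a)) /\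
    (forall n, exists C, forall a l, infinite_sum (fun k => Rabs (a k)) l ->
        sem E n (T a) <= C * l) /\
    (exists n c, 0 < c /\ forall a l, infinite_sum (fun k => Rabs (a k)) l ->
        l <= c * maxsem n (T a)).
End FrechetDefs.

(* Main.v *)
From Stdlib Require Import Reals List Lra Lia Classical.
From mathcomp Require boolp classical_sets.
From mathcomp Require Import choice.
From mathcomp Require Import filter(Filter, Build_Filter, filterT, filterI, filterS, ProperFilter,
  Build_ProperFilter_ex, filter_ex, UltraFilter, ultraFilterLemma, in_ultra_setVsetC).
From Coquelicot Require Import Rcomplements(Rabs_le_between).
Require Import Defs.
Set Bullet Behavior "Strict Subproofs".
Open Scope R_scope.

(** The functionals [f] with [|f| <= m * maxsem m] form balls which exhaust the dual, and by
    the density condition the strong topology on each of them is given by countably many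
    bounded subsets of [E]. Hence, if for every bounded [B] the dual is separable in the
    uniform distance on [B], then the strong dual has a countable network [W]: every [f] lies
    in some [W n] whose members are within [eps] of [f] on a given bounded set.

    (a) => (c). Let [A k] be decreasing sets with [A 0] bounded and [0] in the weak closure
    of every [A k]; fix an ultrafilter [U] containing the [A k] and the weak neighbourhoods
    of [0]. Player I plays members of [U], player II picks elements [b k] of them. If, for
    all balls and all [e > 0], player I can prevent every [f] in the ball from satisfying
    [e <= f (b k)] infinitely often, then combining countably many strategies gives [b k] in
    [A k] with [b k -> 0] weakly. Otherwise some ball is unavoidable. Unavoidability survives
    the constraint [e <= f x] for [U]-almost all [x], and by weak-* compactness of the balls
    also the constraint [f x <= e / 2]; choosing such points successively yields a bounded
    sequence which is independent on the ball, hence a copy of l1.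
    Applied to the complements of finite unions of members of a sigma-locally finite
    k-network, this selection principle gives countably many finite sets of functionals such
    that every [f] is small on [B] on the common kernel of one of them. By Hahn-Banach
    separation [f] is then close on [B] to its span, so the dual is separable on [B], and
    choosing a point in each [W n] makes the strong dual separable.

    (c) => (b). Weakly compact sets are bounded, so the sets "[g x] is within [q'] of [q] for
    all [g] in [W n]", with [q] and [q'] in a countable dense set, and their finite
    intersections form a countable weak k-network. *)

(** * Choice, countability and filters *)

Lemma choice_on {A B : Type} (b0 : B) (D : A -> Prop) (P : A -> B -> Prop) :
  (forall a, D a -> exists b, P a b) -> exists f : A -> B, forall a, D a -> P a (f a).
Proof.
  intros H. destruct (boolp.choice (P := fun a b => D a -> P a b)) as [f Hf]; [|now exists f].
  intros a. destruct (classic (D a)) as [Da|Da].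
  - destruct (H a Da) as [b Pab]. now exists b.
  - exists b0. tauto.
Qed.

Lemma list_choice {A B : Type} (P : A -> B -> Prop) (L : list A) :
  (forall a, In a L -> exists b, P a b) ->
  exists M : list B, (forall a, In a L -> exists b, In b M /\ P a b) /\
                     (forall b, In b M -> exists a, In a L /\ P a b).
Proof.
  induction L as [|a L IH]; intros H.
  - exists nil. split; intros ? [].
  - destruct (H a (or_introl eq_refl)) as [b Pab].
    destruct IH as [M [LM ML]]; [intros a' Ha'; apply H; now right|].
    exists (b :: M). split.
    + intros a' [<-|Ha']; [exists b; split; [now left|auto]|].
      destruct (LM a' Ha') as [b' [Hb' Pab']]. exists b'. split; [now right|auto].
    + intros b' [<-|Hb']; [exists a; split; [now left|auto]|].
      destruct (ML b' Hb') as [a' [Ha' Pab']]. exists a'. split; [now right|auto].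
Qed.

Lemma bounded_comprehension (P : nat -> Prop) n :
  exists l, forall p, In p l <-> (p < n)%nat /\ P p.
Proof.
  exists (List.filter (fun p => boolp.asbool (P p)) (seq 0 n)). intros p.
  rewrite filter_In, in_seq. fold (is_true (boolp.asbool (P p))). rewrite boolp.asboolE.
  split; intros [pn Pp]; (split; [lia|exact Pp]).
Qed.

Lemma countType_enumeration (T : countType) (t0 : T) :
  exists g : nat -> T, forall t, exists n, g n = t.
Proof.
  exists (fun n => match unpickle n with Some t => t | None => t0 end).
  intros t. exists (pickle t). now rewrite pickleK.
Qed.

Lemma dense_sequence :
  exists q : nat -> R, forall r e, 0 < e -> exists n, Rabs (q n - r) < e.
Proof.
  destruct (countType_enumeration (nat * nat * nat)%type (O, O, O)) as [idx Hidx].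
  exists (fun n => let '(a, b, c) := idx n in (INR a - INR b) / INR (S c)).
  intros r e He.
  destruct (archimed_cor1 e He) as [[|c] [Hc Hc0]]; [lia|].
  set (z := up (r * INR (S c))).
  destruct (Hidx (Z.to_nat z, Z.to_nat (- z), c)) as [n Hn]. exists n. rewrite Hn.
  replace (INR (Z.to_nat z) - INR (Z.to_nat (- z))) with (IZR z)
    by (rewrite !INR_IZR_INZ, <- minus_IZR; f_equal; lia).
  assert (Hp : 0 < INR (S c)) by (apply lt_0_INR; lia).
  destruct (archimed (r * INR (S c))) as [z_gt z_le]. fold z in z_gt, z_le.
  replace (IZR z / INR (S c) - r) with ((IZR z - r * INR (S c)) * / INR (S c))
    by (field; lra).
  apply Rinv_0_lt_compat in Hp. rewrite Rabs_pos_eq by (apply Rmult_le_pos; lra). nra.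
Qed.

Lemma Rabs_m1 : Rabs (-1) = 1.
Proof. rewrite Rabs_left; lra. Qed.

Lemma separating_real (A B : R -> Prop) :
  (exists a, A a) -> (exists b, B b) -> (forall a b, A a -> B b -> a <= b) ->
  exists c, (forall a, A a -> a <= c) /\ (forall b, B b -> c <= b).
Proof.
  intros HA [b Bb] AB.
  destruct (completeness A) as [c [ub lub]]; [exists b; intros a Aa; auto|auto|].
  exists c. split; [exact ub|]. intros b' Bb'. apply lub. intros a Aa. auto.
Qed.

Lemma filter_forall_In {X I : Type} {F : (X -> Prop) -> Prop} {FF : Filter F}
    (P : I -> X -> Prop) (L : list I) :
  (forall i, In i L -> F (P i)) -> F (fun x => forall i, In i L -> P i x).
Proof.
  induction L as [|j L IH]; intros H.
  - apply filterS with (2 := filterT). intros x _ i [].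
  - apply filterS with (P := fun x => P j x /\ forall i, In i L -> P i x).
    + intros x [Pj PL] i [->|Hi]; auto.
    + apply filterI; [apply H; now left|]. apply IH. intros i Hi. apply H. now right.
Qed.

Definition eventually (P : nat -> Prop) : Prop := exists N, forall n, (N <= n)%nat -> P n.

#[local] Instance eventually_filter : ProperFilter eventually.
Proof.
  apply Build_ProperFilter_ex; [intros P [N HN]; exists N; auto|].
  apply Build_Filter.
  - now exists O.
  - intros P Q [N HN] [M HM]. exists (N + M)%nat.
    intros n Hn. split; [apply HN|apply HM]; lia.
  - intros P Q PQ [N HN]. exists N. intros n Hn. apply PQ. auto.
Qed.

Lemma eventually_gt N : eventually (fun n => (N < n)%nat).
Proof. now exists (S N). Qed.

Lemma eventually_shift i (P : nat -> Prop) :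
  eventually (fun k => P (i + k)%nat) -> eventually P.
Proof.
  intros [N HN]. exists (i + N)%nat. intros n Hn.
  replace n with (i + (n - i))%nat by lia. apply HN. lia.
Qed.

Definition tends_to {X : Type} (F : (X -> Prop) -> Prop) (h : X -> R) (r : R) : Prop :=
  forall eps, 0 < eps -> F (fun x => Rabs (h x - r) < eps).

Section TendsTo.
Context {X : Type} {F : (X -> Prop) -> Prop}.

Lemma tends_to_plus {FF : Filter F} (g h : X -> R) r s :
  tends_to F g r -> tends_to F h s -> tends_to F (fun x => g x + h x) (r + s).
Proof.
  intros Hg Hh eps Heps.
  apply filterS with (2 := filterI (F := F) (Hg (eps / 2) ltac:(lra)) (Hh (eps / 2) ltac:(lra))).
  intros x [gx hx]. apply Rabs_def2 in gx, hx. apply Rabs_def1; lra.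
Qed.

Lemma tends_to_scal {FF : Filter F} (h : X -> R) c r :
  tends_to F h r -> tends_to F (fun x => c * h x) (c * r).
Proof.
  intros Hh eps Heps. pose proof (Rabs_pos c).
  apply filterS with (2 := Hh (eps / (Rabs c + 1)) ltac:(apply Rdiv_lt_0_compat; lra)).
  intros x hx. rewrite <- Rmult_minus_distr_l, Rabs_mult.
  apply Rmult_lt_compat_l with (r := Rabs c + 1) in hx; [|lra].
  replace ((Rabs c + 1) * (eps / (Rabs c + 1))) with eps in hx by (field; lra).
  pose proof (Rabs_pos (h x - r)). lra.
Qed.

Lemma tends_to_le {FF : ProperFilter F} (h : X -> R) c r :
  F (fun x => h x <= c) -> tends_to F h r -> r <= c.
Proof.
  intros Hc Hr. apply Rnot_lt_le. intros Hlt.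
  destruct (filter_ex (F := F) (filterI Hc (Hr (r - c) ltac:(lra)))) as [x [hc hr]].
  apply Rabs_def2 in hr. lra.
Qed.

Lemma tends_to_ge {FF : ProperFilter F} (h : X -> R) c r :
  F (fun x => c <= h x) -> tends_to F h r -> c <= r.
Proof.
  intros Hc Hr. apply Rnot_lt_le. intros Hlt.
  destruct (filter_ex (F := F) (filterI Hc (Hr (c - r) ltac:(lra)))) as [x [hc hr]].
  apply Rabs_def2 in hr. lra.
Qed.

Lemma tends_to_dist_le {FF : ProperFilter F} (h : X -> R) a c r :
  F (fun x => Rabs (h x - a) <= c) -> tends_to F h r -> Rabs (r - a) <= c.
Proof.
  intros Hc Hr. apply Rabs_le. split.
  - enough (a - c <= r) by lra. apply tends_to_ge with (2 := Hr).
    apply filterS with (2 := Hc). intros x hx. apply Rabs_le_between in hx. lra.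
  - enough (r <= a + c) by lra. apply tends_to_le with (2 := Hr).
    apply filterS with (2 := Hc). intros x hx. apply Rabs_le_between in hx. lra.
Qed.

Lemma tends_to_unique {FF : ProperFilter F} (h : X -> R) r s :
  tends_to F h r -> tends_to F h s -> r = s.
Proof.
  intros Hr Hs. apply cond_eq. intros eps Heps.
  apply Rle_lt_trans with (eps / 2); [|lra]. apply tends_to_dist_le with (2 := Hr).
  apply filterS with (2 := Hs (eps / 2) ltac:(lra)). intros x hx. now left.
Qed.

Lemma ultrafilter_not {UF : UltraFilter F} (P : X -> Prop) : ~ F P -> F (fun x => ~ P x).
Proof. intros nP. now destruct (in_ultra_setVsetC P UF). Qed.

Lemma bounded_tends_to_ultrafilter {UF : UltraFilter F} (h : X -> R) M :
  (forall x, Rabs (h x) <= M) -> exists r, tends_to F h r.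
Proof.
  intros HM.
  destruct (separating_real (fun t => F (fun x => t <= h x)) (fun t => F (fun x => h x <= t)))
    as [r [lower upper]].
  - exists (- M). apply filterS with (2 := filterT). intros x _.
    specialize (HM x). apply Rabs_le_between in HM. lra.
  - exists M. apply filterS with (2 := filterT). intros x _.
    specialize (HM x). apply Rabs_le_between in HM. lra.
  - intros s t Hs Ht. destruct (filter_ex (F := F) (filterI Hs Ht)) as [x [sx xt]]. lra.
  - exists r. intros eps Heps.
    assert (below : F (fun x => ~ r + eps <= h x)).
    { apply ultrafilter_not. intros H. apply lower in H. lra. }
    assert (above : F (fun x => ~ h x <= r - eps)).
    { apply ultrafilter_not. intros H. apply upper in H. lra. }
    apply filterS with (2 := filterI (F := F) below above). intros x [hb ha]. apply Rabs_def1; lra.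
Qed.

End TendsTo.

(** * Compact sets, networks and metrizable subsets *)

Section Topology.
Context {X : Type} {open : (X -> Prop) -> Prop}.

Lemma compact_increasing_cover (K : X -> Prop) (U : nat -> X -> Prop) :
  compact X open K -> (forall n, open (U n)) ->
  (forall m n x, (m <= n)%nat -> U m x -> U n x) -> (forall x, K x -> exists n, U n x) ->
  exists n, forall x, K x -> U n x.
Proof.
  intros HK Uopen Umono KU.
  destruct (HK (fun V => exists n, V = U n)) as [L [LU KL]].
  - intros V [n ->]. apply Uopen.
  - intros x Kx. destruct (KU x Kx) as [n Ux]. exists (U n). eauto.
  - assert (absorbs : eventually (fun n => forall V, In V L -> forall x, V x -> U n x)).
    { apply filter_forall_In. intros V HV. destruct (LU V HV) as [m ->].
      exists m. intros n Hn x. now apply Umono. }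
    destruct (filter_ex absorbs) as [n Hn]. exists n. intros x Kx.
    destruct (KL x Kx) as [V [HV Vx]]. eauto.
Qed.

Definition converges (b : nat -> X) (x : X) : Prop :=
  forall W, open W -> W x -> eventually (fun k => W (b k)).

Lemma compact_convergent_sequence (b : nat -> X) x :
  converges b x -> compact X open (fun y => y = x \/ exists k, y = b k).
Proof.
  intros Hb cov cov_open Hcov.
  destruct (Hcov x (or_introl eq_refl)) as [W [CW Wx]].
  destruct (Hb W (cov_open W CW) Wx) as [N HN].
  destruct (list_choice (fun k V => cov V /\ V (b k)) (seq 0 N)) as [L [bL Lb]].
  - intros k _. apply Hcov. right. now exists k.
  - exists (W :: L). split.
    + intros V [<-|HV]; [exact CW|]. destruct (Lb V HV) as [k [_ [CV _]]]. exact CV.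
    + intros y [->|[k ->]]; [exists W; split; [now left|exact Wx]|].
      destruct (Nat.lt_ge_cases k N) as [Hk|Hk].
      * destruct (bL k) as [V [HV [_ Vb]]]; [apply in_seq; lia|].
        exists V. split; [now right|exact Vb].
      * exists W. split; [now left|auto].
Qed.

Lemma k_network_of_local (N : (X -> Prop) -> Prop) :
  (forall K U x, compact X open K -> open U -> (forall y, K y -> U y) -> K x ->
     exists V S, open V /\ V x /\ N S /\ (forall y, K y -> V y -> S y) /\
                 (forall y, S y -> U y)) ->
  k_network X open N.
Proof.
  intros Hloc K U HK HU KU.
  destruct (HK (fun V => open V /\ exists S, N S /\ (forall y, K y -> V y -> S y) /\
                         (forall y, S y -> U y))) as [L [HL KL]].
  - now intros V [HV _].
  - intros x Kx. destruct (Hloc K U x HK HU KU Kx) as [V [S [HV [Vx [NS [VS SU]]]]]].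
    exists V. split; [split; [auto|now exists S]|exact Vx].
  - destruct (list_choice (fun V S => N S /\ (forall y, K y -> V y -> S y) /\
                                      (forall y, S y -> U y)) L) as [F [LF FL]].
    { intros V HV. apply (HL V HV). }
    exists F. split; [|split].
    + intros S HS. destruct (FL S HS) as [V [_ [NS _]]]. exact NS.
    + intros x Kx. destruct (KL x Kx) as [V [HV Vx]].
      destruct (LF V HV) as [S [HS [_ [VS _]]]]. exists S. auto.
    + intros S HS. destruct (FL S HS) as [V [_ [_ [_ SU]]]]. exact SU.
Qed.

Definition locally_enumerated (N : (X -> Prop) -> Prop) (x : X) (enum : nat -> X -> Prop) :=
  forall S, N S ->
    (exists p, enum p = S) \/ exists W, open W /\ W x /\ forall y, W y -> ~ S y.

Lemma sigma_locally_finite_locally_enumerated (N : (X -> Prop) -> Prop) x :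
  sigma_locally_finite X open N -> exists enum, locally_enumerated N x enum.
Proof.
  intros [Nk [Nk_finite NE]].
  destruct (boolp.choice (fun k => Nk_finite k x)) as [W HW].
  destruct (boolp.choice (fun k => proj2 (proj2 (HW k)))) as [L HL].
  destruct (countType_enumeration (nat * nat)%type (O, O)) as [idx Hidx].
  exists (fun p => let (k, j) := idx p in nth j (L k) (fun _ => False)).
  intros S NS. destruct (proj1 (NE S) NS) as [k Sk].
  destruct (classic (In S (L k))) as [SL|SL].
  - left. destruct (In_nth _ _ (fun _ => False) SL) as [j [_ Hj]].
    destruct (Hidx (k, j)) as [p Hp]. exists p. now rewrite Hp.
  - right. exists (W k). destruct (HW k) as [Wopen [Wx _]]. split; [|split]; auto.
    intros y Wy Sy. apply SL. apply HL; eauto.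
Qed.

Lemma k_network_catches_sequence N enum x (U : X -> Prop) (b : nat -> X) :
  k_network X open N -> locally_enumerated N x enum -> open U -> U x ->
  (forall k, U (b k)) -> converges b x ->
  exists k p, (p < k)%nat /\ (forall y, enum p y -> U y) /\ enum p (b k).
Proof.
  intros HN Henum HU Ux Ub Hb.
  destruct (HN _ U (compact_convergent_sequence b x Hb) HU) as [F [FN [bF FU]]].
  { intros y [->|[k ->]]; auto. }
  assert (enumerated : eventually (fun k => forall S, In S F -> S (b k) ->
                                     exists p, (p < k)%nat /\ enum p = S)).
  { apply filter_forall_In. intros S HS.
    destruct (Henum S (FN S HS)) as [[p Hp]|[W [Wopen [Wx WS]]]].
    - apply filterS with (2 := eventually_gt p). intros k Hk _. now exists p.
    - apply filterS with (2 := Hb W Wopen Wx). intros k Wb Sb. now destruct (WS _ Wb). }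
  destruct (filter_ex enumerated) as [k Hk].
  destruct (bF (b k)) as [S [HS Sb]]; [right; now exists k|].
  destruct (Hk S HS Sb) as [p [pk <-]]. exists k, p. split; [|split]; auto.
  now apply FU.
Qed.

Lemma metrizable_subset_first_countable (A : X -> Prop) x :
  metrizable_subset X open A -> A x ->
  exists V : nat -> X -> Prop, (forall k, open (V k) /\ V k x) /\
    forall U, open U -> U x -> exists k, forall y, A y -> V k y -> U y.
Proof.
  intros [d [_ [d_eq0 [_ [d_triangle d_open]]]]] Ax.
  assert (ball : forall k, exists V, open V /\
                   forall y, A y -> (A y /\ d x y < / INR (S k) <-> V y)).
  { intros k. apply d_open; [tauto|]. intros y [Ay xy].
    exists (/ INR (S k) - d x y). split; [lra|]. intros z Az yz. split; [exact Az|].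
    pose proof (d_triangle x y z Ax Ay Az). lra. }
  destruct (boolp.choice ball) as [V HV]. exists V. split.
  - intros k. split; [apply HV|]. apply HV; [exact Ax|]. split; [exact Ax|].
    rewrite (proj2 (d_eq0 x x Ax Ax) eq_refl). apply Rinv_0_lt_compat, lt_0_INR. lia.
  - intros U HU Ux.
    destruct (proj1 (d_open (fun y => A y /\ U y) (fun y H => proj1 H))) with x
      as [r [Hr Hball]]; [exists U; split; [exact HU|tauto]|auto|].
    destruct (archimed_cor1 r Hr) as [[|k] [Hk Hk0]]; [lia|].
    exists k. intros y Ay Vy. apply HV in Vy; [|exact Ay]. apply Hball; [exact Ay|lra].
Qed.

Lemma aleph0_space_aleph_space : open (fun _ => True) -> aleph0_space X open -> aleph_space X open.
Proof.
  intros open_full [Hreg [N [HN [g Hg]]]]. split; [exact Hreg|]. exists N. split; [exact HN|].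
  exists (fun k S => N S /\ g k = S). split.
  - intros k x. exists (fun _ => True). split; [exact open_full|]. split; [exact I|].
    exists (g k :: nil). intros S [_ HS] _. now left.
  - intros S. split.
    + intros NS. destruct (Hg S NS) as [k Hk]. now exists k.
    + now intros [k [NS _]].
Qed.

End Topology.

Local Arguments converges {X} open b x.
Local Arguments locally_enumerated {X} open N x enum.

(** * Strategies depending on the past moves *)

Section History.
Context {X : Type}.

Definition hist (b : nat -> X) (k : nat) : list X := map b (seq 0 k).

Lemma hist_S (b : nat -> X) k : hist b (S k) = hist b k ++ b k :: nil.
Proof. unfold hist. now rewrite seq_S, map_app. Qed.

Lemma hist_add (b : nat -> X) i k : hist b (i + k) = hist b i ++ hist (fun j => b (i + j)%nat) k.
Proof.
  induction k as [|k IH].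
  - now rewrite Nat.add_0_r, app_nil_r.
  - now rewrite Nat.add_succ_r, !hist_S, IH, app_assoc.
Qed.

Lemma hist_length (b : nat -> X) k : length (hist b k) = k.
Proof. unfold hist. now rewrite length_map, length_seq. Qed.

Definition follows (strat : list X -> X -> Prop) (b : nat -> X) : Prop :=
  forall k, strat (hist b k) (b k).

Lemma follows_exists (strat : list X -> X -> Prop) :
  (forall l, exists a, strat l a) -> exists b, follows strat b.
Proof.
  intros H. destruct (boolp.choice H) as [next Hnext].
  set (past := fix past k := match k with O => nil | S k' => past k' ++ next (past k') :: nil end).
  exists (fun k => next (past k)). intros k.
  replace (hist (fun k => next (past k)) k) with (past k); [apply Hnext|].
  induction k as [|k IH]; [reflexivity|]. now rewrite hist_S, <- IH.
Qed.

(* After every initial position [h], the strategy [next h] is started afresh. *)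
Definition merge (next : list X -> list X -> X -> Prop) (l : list X) (x : X) : Prop :=
  forall h t, l = h ++ t -> next h t x.

Lemma follows_merge next b i :
  follows (merge next) b -> follows (next (hist b i)) (fun k => b (i + k)%nat).
Proof. intros H k. apply H, hist_add. Qed.

Lemma filter_merge (F : (X -> Prop) -> Prop) {FF : Filter F} next l :
  (forall h t, F (next h t)) -> F (merge next l).
Proof.
  revert next. induction l as [|a l IH]; intros next Hnext.
  - apply filterS with (2 := Hnext nil nil). intros x Hx h t Hl.
    symmetry in Hl. now apply app_eq_nil in Hl as [-> ->].
  - apply filterS with (2 := filterI (Hnext nil (a :: l))
      (IH (fun h => next (a :: h)) (fun h => Hnext (a :: h)))).
    intros x [Hnil Hcons] [|a' h] t Hl; [now rewrite <- (Hl : _ = t)|].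
    injection Hl as <- Hl. now apply Hcons.
Qed.

End History.

(** * Seminorms and functionals on a Frechet space *)

Local Notation "x [+] y" := (vadd _ x y) (at level 50, left associativity).
Local Notation "c [*] x" := (vscal _ c x) (at level 40, left associativity).
Local Arguments sem {_} n x.
Local Arguments maxsem {_} n x.
Local Arguments vsub {_} x y.
Local Arguments ev {_} f x.
Local Arguments is_linear {_} f.
Local Arguments E_bounded {_} B.

Section FrechetSpace.
Variable E : Frechet.
Local Notation dual := (dual E).
Implicit Types (x y z : E) (f g h : dual) (B K : E -> Prop).

Lemma vadd_0l x : v0 E [+] x = x.
Proof. now rewrite vaddC, vadd0. Qed.

Lemma vadd_cancel_r x y z : x [+] z = y [+] z -> x = y.
Proof.
  intros H. apply (f_equal (fun w => w [+] vopp E z)) in H.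
  now rewrite <- !vaddA, !vaddN, !vadd0 in H.
Qed.

Lemma vadd_swap (x y z w : E) : (x [+] y) [+] (z [+] w) = (x [+] z) [+] (y [+] w).
Proof. rewrite <- !vaddA. f_equal. rewrite !vaddA. f_equal. apply vaddC. Qed.

Lemma vscal_0l x : 0 [*] x = v0 E.
Proof.
  apply vadd_cancel_r with (0 [*] x). rewrite vadd_0l, <- vscalDl. f_equal. lra.
Qed.

Lemma vopp_scal x : vopp E x = (-1) [*] x.
Proof.
  apply vadd_cancel_r with x. rewrite vaddC, vaddN.
  rewrite <- (vscal1 E x) at 2. rewrite <- vscalDl.
  replace (-1 + 1) with 0 by lra. now rewrite vscal_0l.
Qed.

Lemma vadd_opp x : x [+] (-1) [*] x = v0 E.
Proof. rewrite <- vopp_scal. apply vaddN. Qed.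

Lemma vsub_add (x y z w : E) : vsub (x [+] y) (z [+] w) = vsub x z [+] vsub y w.
Proof. unfold vsub. rewrite !vopp_scal, vscalDr. apply vadd_swap. Qed.

Lemma vsub_scal c x y : vsub (c [*] x) (c [*] y) = c [*] vsub x y.
Proof. unfold vsub. rewrite !vopp_scal, vscalDr, !vscalA. do 2 f_equal. ring. Qed.

Lemma vsub_self x : vsub x x = v0 E.
Proof. apply vaddN. Qed.

Lemma vsub_opp x y : vsub x y = (-1) [*] vsub y x.
Proof.
  unfold vsub. rewrite !vopp_scal, vscalDr, !vscalA, vaddC.
  replace (-1 * -1) with 1 by ring. now rewrite vscal1.
Qed.

Lemma vsub_addK x y : vsub x y [+] y = x.
Proof. unfold vsub. now rewrite <- vaddA, (vaddC E _ y), vaddN, vadd0. Qed.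

Lemma vsub_trans x y z : vsub x z = vsub x y [+] vsub y z.
Proof. apply vadd_cancel_r with z. now rewrite <- vaddA, !vsub_addK. Qed.

Lemma vsub_eq0 x y : vsub x y = v0 E -> x = y.
Proof. intros H. now rewrite <- (vsub_addK x y), H, vadd_0l. Qed.

Lemma sem_0 n : sem n (v0 E) = 0.
Proof. rewrite <- (vscal_0l (v0 E)), sem_homog, Rabs_R0. ring. Qed.

Lemma sem_opp n x : sem n ((-1) [*] x) = sem n x.
Proof. rewrite sem_homog, Rabs_m1. ring. Qed.

Lemma sem_sub_sym n x y : sem n (vsub x y) = sem n (vsub y x).
Proof. rewrite (vsub_opp x y). apply sem_opp. Qed.

Lemma sem_sub_triangle n x y z : sem n (vsub x z) <= sem n (vsub x y) + sem n (vsub y z).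
Proof. rewrite (vsub_trans x y z). apply sem_triangle. Qed.

Lemma sem_ge0 n x : 0 <= sem n x.
Proof.
  pose proof (sem_triangle E n x ((-1) [*] x)) as H.
  rewrite vadd_opp, sem_0, sem_opp in H. lra.
Qed.

Lemma sem_le_maxsem n i x : (i <= n)%nat -> sem i x <= maxsem n x.
Proof.
  induction n as [|n IH]; intros H; simpl.
  - replace i with O by lia. lra.
  - destruct (Nat.eq_dec i (S n)) as [->|Hn]; [apply Rmax_r|].
    apply Rle_trans with (2 := Rmax_l _ _). apply IH. lia.
Qed.

Lemma maxsem_le n x M : (forall i, (i <= n)%nat -> sem i x <= M) -> maxsem n x <= M.
Proof.
  induction n as [|n IH]; intros H; simpl; [now apply H|].
  apply Rmax_lub; [|now apply H]. apply IH. intros i Hi. apply H. lia.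
Qed.

Lemma maxsem_mono n m x : (n <= m)%nat -> maxsem n x <= maxsem m x.
Proof. intros H. apply maxsem_le. intros i Hi. apply sem_le_maxsem. lia. Qed.

Lemma maxsem_ge0 n x : 0 <= maxsem n x.
Proof. apply Rle_trans with (sem n x); [apply sem_ge0|now apply sem_le_maxsem]. Qed.

Lemma maxsem_triangle n x y : maxsem n (x [+] y) <= maxsem n x + maxsem n y.
Proof.
  apply maxsem_le. intros i Hi. apply Rle_trans with (1 := sem_triangle E i x y).
  apply Rplus_le_compat; now apply sem_le_maxsem.
Qed.

Lemma maxsem_homog n c x : maxsem n (c [*] x) = Rabs c * maxsem n x.
Proof.
  induction n as [|n IH]; simpl; [apply sem_homog|].
  rewrite IH, sem_homog. apply RmaxRmult. apply Rabs_pos.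
Qed.

Lemma maxsem_bounded_on B n : E_bounded B -> exists M, forall x, B x -> maxsem n x <= M.
Proof.
  intros HB. induction n as [|n [M HM]]; [apply HB|].
  destruct (HB (S n)) as [M' HM']. exists (Rmax M M'). intros x Bx.
  apply Rmax_lub; [apply Rle_trans with (2 := Rmax_l _ _)|apply Rle_trans with (2 := Rmax_r _ _)];
    auto.
Qed.

Lemma ev_add f x y : ev f (x [+] y) = ev f x + ev f y.
Proof. apply (proj1 (proj1 (proj2_sig f))). Qed.

Lemma ev_scal f c x : ev f (c [*] x) = c * ev f x.
Proof. apply (proj2 (proj1 (proj2_sig f))). Qed.

Lemma ev_0 f : ev f (v0 E) = 0.
Proof. rewrite <- (vscal_0l (v0 E)), ev_scal. ring. Qed.

Lemma ev_sub f x y : ev f (vsub x y) = ev f x - ev f y.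
Proof. unfold vsub. rewrite ev_add, vopp_scal, ev_scal. ring. Qed.

Definition dual_ball (n : nat) (c : R) (f : dual) : Prop :=
  forall x, Rabs (ev f x) <= c * maxsem n x.

Lemma bounded_linear_in_dual_ball (q : E -> R) n c :
  is_linear q -> (forall x, Rabs (q x) <= c * maxsem n x) ->
  exists f, dual_ball n c f /\ forall x, ev f x = q x.
Proof.
  intros q_linear q_bound.
  now exists (exist _ q (conj q_linear (ex_intro _ n (ex_intro _ c q_bound)))).
Qed.

Lemma dual_ball_mono n m c d f : (n <= m)%nat -> 0 <= c <= d -> dual_ball n c f -> dual_ball m d f.
Proof.
  intros nm cd Hf x. apply Rle_trans with (1 := Hf x).
  apply Rmult_le_compat; [lra|apply maxsem_ge0|lra|now apply maxsem_mono].
Qed.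

Lemma dual_ball_exhaust f : exists m, dual_ball m (INR m) f.
Proof.
  destruct f as [f [Hl [n [C HC]]]]. destruct (INR_unbounded C) as [k Hk].
  exists (n + k)%nat. apply (dual_ball_mono n _ (INR k)); [lia| |].
  - rewrite plus_INR. pose proof (pos_INR n). pose proof (pos_INR k). lra.
  - intros x. apply Rle_trans with (1 := HC x).
    apply Rmult_le_compat_r; [apply maxsem_ge0|lra].
Qed.

Lemma dual_ball_strong_bounded n c : 0 <= c -> strong_bounded E (dual_ball n c).
Proof.
  intros Hc B HB. destruct (maxsem_bounded_on B n HB) as [M HM].
  exists (c * M). intros f x Hf Bx. apply Rle_trans with (1 := Hf x).
  apply Rmult_le_compat_l; auto.
Qed.

Lemma dual_bounded_on B f : E_bounded B -> exists M, 0 <= M /\ forall x, B x -> Rabs (ev f x) <= M.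
Proof.
  intros HB. destruct (dual_ball_exhaust f) as [m Hm].
  destruct (dual_ball_strong_bounded m (INR m) (pos_INR m) B HB) as [M HM].
  exists (Rabs M). split; [apply Rabs_pos|]. intros x Bx.
  apply Rle_trans with (2 := Rle_abs M). auto.
Qed.

Lemma zero_dual :
  is_linear (fun _ : E => 0) /\ exists n c, forall x, Rabs 0 <= c * maxsem n x.
Proof.
  split; [split; intros; ring|]. exists O, 0. intros x. rewrite Rabs_R0. lra.
Qed.

Definition dual_zero : dual := exist _ (fun _ => 0) zero_dual.

Lemma ev_zero x : ev dual_zero x = 0.
Proof. reflexivity. Qed.

Lemma axpy_dual c f g :
  is_linear (fun x => ev f x + c * ev g x) /\
  exists n C, forall x, Rabs (ev f x + c * ev g x) <= C * maxsem n x.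
Proof.
  split; [split; intros; rewrite ?ev_add, ?ev_scal; ring|].
  destruct (dual_ball_exhaust f) as [m Hf]. destruct (dual_ball_exhaust g) as [n Hg].
  apply (dual_ball_mono m (m + n) _ (INR m)) in Hf; [|lia|split; [apply pos_INR|lra]].
  apply (dual_ball_mono n (m + n) _ (INR n)) in Hg; [|lia|split; [apply pos_INR|lra]].
  exists (m + n)%nat, (INR m + Rabs c * INR n). intros x.
  apply Rle_trans with (1 := Rabs_triang _ _).
  rewrite Rabs_mult, Rmult_plus_distr_r, Rmult_assoc.
  apply Rplus_le_compat; [apply Hf|]. apply Rmult_le_compat_l; [apply Rabs_pos|apply Hg].
Qed.

Definition dual_axpy (c : R) (f g : dual) : dual := exist _ _ (axpy_dual c f g).

Lemma ev_axpy c f g x : ev (dual_axpy c f g) x = ev f x + c * ev g x.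
Proof. reflexivity. Qed.

Definition close_on (B : E -> Prop) (e : R) (f g : dual) : Prop :=
  forall x, B x -> Rabs (ev f x - ev g x) <= e.

Lemma close_on_sym B e f g : close_on B e f g -> close_on B e g f.
Proof. intros H x Bx. rewrite Rabs_minus_sym. now apply H. Qed.

Lemma close_on_trans B d e f g h :
  close_on B d f g -> close_on B e g h -> close_on B (d + e) f h.
Proof.
  intros fg gh x Bx. specialize (fg x Bx). specialize (gh x Bx).
  apply Rabs_le_between in fg, gh. apply Rabs_le. lra.
Qed.

Lemma close_on_le B d e f g : d <= e -> close_on B d f g -> close_on B e f g.
Proof. intros de fg x Bx. apply Rle_trans with (2 := de). auto. Qed.

Lemma close_on_refl B e f : 0 <= e -> close_on B e f f.
Proof. intros He x _. now rewrite Rminus_diag, Rabs_R0. Qed.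

Lemma strong_open_close_on_lt B f e :
  E_bounded B -> strong_open E (fun g => exists d, d < e /\ close_on B d g f).
Proof.
  intros HB g [d [de gf]]. exists B, ((e - d) / 2). split; [exact HB|]. split; [lra|].
  intros h hg. exists ((e - d) / 2 + d). split; [lra|]. now apply close_on_trans with g.
Qed.

(** * Weak neighbourhoods *)

Definition weak_nbhd (x : E) (A : E -> Prop) : Prop :=
  exists (L : list dual) eps, 0 < eps /\
    forall y, (forall f, In f L -> Rabs (ev f (vsub y x)) < eps) -> A y.

#[local] Instance weak_nbhd_filter x : Filter (weak_nbhd x).
Proof.
  apply Build_Filter.
  - exists nil, 1. split; [lra|]. intros y _. exact I.
  - intros A B [L [d [Hd HA]]] [M [e [He HB]]].
    exists (L ++ M), (Rmin d e). split; [now apply Rmin_glb_lt|]. intros y Hy. split.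
    + apply HA. intros f Hf. apply Rlt_le_trans with (2 := Rmin_l d e).
      apply Hy, in_or_app. now left.
    + apply HB. intros f Hf. apply Rlt_le_trans with (2 := Rmin_r d e).
      apply Hy, in_or_app. now right.
  - intros A B AB [L [d [Hd HA]]]. exists L, d. split; [exact Hd|].
    intros y Hy. apply AB. auto.
Qed.

Lemma weak_nbhd_ev x f eps : 0 < eps -> weak_nbhd x (fun y => Rabs (ev f y - ev f x) < eps).
Proof.
  intros Heps. exists (f :: nil), eps. split; [exact Heps|]. intros y Hy.
  rewrite <- ev_sub. apply Hy. now left.
Qed.

Lemma weak_open_ev_preimage f (P : R -> Prop) :
  (forall s, P s -> exists eps, 0 < eps /\ forall t, Rabs (t - s) < eps -> P t) ->
  weak_open E (fun x => P (ev f x)).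
Proof.
  intros Popen x Px. destruct (Popen _ Px) as [eps [Heps HP]].
  apply filterS with (2 := weak_nbhd_ev x f eps Heps). intros y. apply HP.
Qed.

Lemma weak_open_dist_lt f c r : weak_open E (fun x => Rabs (ev f x - c) < r).
Proof.
  apply (weak_open_ev_preimage f (fun s => Rabs (s - c) < r)). intros s Hs.
  exists (r - Rabs (s - c)). split; [lra|]. intros t Ht.
  pose proof (Rabs_triang (t - s) (s - c)) as T.
  replace (t - s + (s - c)) with (t - c) in T by ring. lra.
Qed.

Lemma weak_open_dist_gt f c r : weak_open E (fun x => r < Rabs (ev f x - c)).
Proof.
  apply (weak_open_ev_preimage f (fun s => r < Rabs (s - c))). intros s Hs.
  exists (Rabs (s - c) - r). split; [lra|]. intros t Ht. rewrite Rabs_minus_sym in Ht.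
  pose proof (Rabs_triang (s - t) (t - c)) as T.
  replace (s - t + (t - c)) with (s - c) in T by ring. lra.
Qed.

Lemma weak_open_forall_In {I : Type} (P : I -> E -> Prop) (L : list I) :
  (forall i, In i L -> weak_open E (P i)) ->
  weak_open E (fun x => forall i, In i L -> P i x).
Proof.
  intros HP x Px. apply (filter_forall_In (F := weak_nbhd x)).
  intros i Hi. apply (HP i Hi). auto.
Qed.

Lemma weak_open_exists {I : Type} (P : I -> E -> Prop) :
  (forall i, weak_open E (P i)) -> weak_open E (fun x => exists i, P i x).
Proof.
  intros HP x [i Px]. apply (filterS (F := weak_nbhd x)) with (2 := HP i x Px). now exists i.
Qed.

(** * Compactness of the balls of the dual *)

Lemma dual_ball_ultralimit {X : Type} (U : (X -> Prop) -> Prop) {UU : UltraFilter U}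
    n c (F : X -> dual) :
  (forall t, dual_ball n c (F t)) ->
  exists f, dual_ball n c f /\ forall x, tends_to U (fun t => ev (F t) x) (ev f x).
Proof.
  intros HF.
  destruct (boolp.choice (P := fun x r => tends_to U (fun t => ev (F t) x) r)) as [q Hq].
  { intros x. apply bounded_tends_to_ultrafilter with (c * maxsem n x). intros t. apply HF. }
  destruct (bounded_linear_in_dual_ball q n c) as [f [Bf fq]].
  - split.
    + intros x y. apply (tends_to_unique (F := U)) with (1 := Hq (x [+] y)).
      intros eps Heps. apply filterS with (2 := tends_to_plus _ _ _ _ (Hq x) (Hq y) eps Heps).
      intros t. now rewrite ev_add.
    + intros a x. apply (tends_to_unique (F := U)) with (1 := Hq (a [*] x)).
      intros eps Heps. apply filterS with (2 := tends_to_scal _ a _ (Hq x) eps Heps).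
      intros t. now rewrite ev_scal.
  - intros x. rewrite <- (Rminus_0_r (q x)). apply (tends_to_dist_le (F := U)) with (2 := Hq x).
    apply filterS with (2 := filterT). intros t _. rewrite Rminus_0_r. apply HF.
  - exists f. split; [exact Bf|]. intros x. rewrite fq. apply Hq.
Qed.

Lemma dual_ball_finite_subcover {I : Type} n c (a : I -> E) (e : I -> R) :
  (forall f, dual_ball n c f -> exists i, ev f (a i) < e i) ->
  exists L, forall f, dual_ball n c f -> exists i, In i L /\ ev f (a i) < e i.
Proof.
  intros Hcov. apply NNPP. intros no_subcover.
  destruct (boolp.choice (P := fun L f => dual_ball n c f /\
                                 forall i, In i L -> e i <= ev f (a i))) as [F HF].
  { intros L. apply NNPP. intros Hno. apply no_subcover. exists L. intros f Bf.
    apply NNPP. intros Hf. apply Hno. exists f. split; [exact Bf|].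
    intros i Hi. apply Rnot_lt_le. intros Hlt. apply Hf. now exists i. }
  set (tails := fun S : list I -> Prop => exists L, forall M, incl L M -> S M).
  assert (tails_proper : ProperFilter tails).
  { apply Build_ProperFilter_ex; [intros S [L HL]; exists L; apply HL, incl_refl|].
    apply Build_Filter.
    - now exists nil.
    - intros S T [L HL] [M HM]. exists (L ++ M). intros N LMN.
      apply incl_app_inv in LMN. split; [now apply HL|now apply HM].
    - intros S T ST [L HL]. exists L. auto. }
  destruct (ultraFilterLemma tails_proper) as [U [UU tailsU]].
  destruct (dual_ball_ultralimit U n c F) as [f [Bf Uf]]; [intros L; apply HF|].
  destruct (Hcov f Bf) as [i Hi].
  apply (Rlt_not_le _ _ Hi), (tends_to_ge (F := U)) with (2 := Uf (a i)).
  apply tailsU. exists (i :: nil). intros M iM. apply HF, iM. now left.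
Qed.

Lemma dual_telescoping_limit n (s : nat -> dual) (w : nat -> R) :
  (forall k, 0 <= w k) ->
  (forall k x, Rabs (ev (s (S k)) x - ev (s k) x) <= (w k - w (S k)) * maxsem n x) ->
  exists f, forall k x, Rabs (ev f x - ev (s k) x) <= w k * maxsem n x.
Proof.
  intros w_ge0 Hstep.
  assert (tail : forall k j x, Rabs (ev (s (j + k)%nat) x - ev (s k) x)
                   <= (w k - w (j + k)%nat) * maxsem n x).
  { intros k j x. induction j as [|j IH].
    - simpl. rewrite !Rminus_diag, Rabs_R0. lra.
    - specialize (Hstep (j + k)%nat x). simpl. apply Rabs_le_between in IH, Hstep.
      apply Rabs_le. lra. }
  assert (tail_le : forall k j x, Rabs (ev (s (j + k)%nat) x - ev (s k) x) <= w k * maxsem n x).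
  { intros k j x. apply Rle_trans with (1 := tail k j x).
    apply Rmult_le_compat_r; [apply maxsem_ge0|]. specialize (w_ge0 (j + k)%nat). lra. }
  destruct (ultraFilterLemma eventually_filter) as [U [UU eventuallyU]].
  destruct (dual_ball_ultralimit U n (w O) (fun k => dual_axpy (-1) (s k) (s O)))
    as [h [_ Hh]].
  { intros k x. rewrite ev_axpy, <- (Nat.add_0_r k).
    replace (ev (s (k + 0)%nat) x + -1 * ev (s O) x)
      with (ev (s (k + 0)%nat) x - ev (s O) x) by ring. apply tail_le. }
  exists (dual_axpy 1 h (s O)). intros k x. rewrite ev_axpy.
  replace (ev h x + 1 * ev (s O) x - ev (s k) x)
    with (ev h x - (ev (s k) x - ev (s O) x)) by ring.
  apply (tends_to_dist_le (F := U)) with (2 := Hh x). apply eventuallyU.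
  exists k. intros j Hj. rewrite ev_axpy.
  replace (ev (s j) x + -1 * ev (s O) x - (ev (s k) x - ev (s O) x))
    with (ev (s j) x - ev (s k) x) by ring.
  replace j with ((j - k) + k)%nat by lia. apply tail_le.
Qed.

(** * The Hahn-Banach theorem *)

Definition sublinear (q : E -> R) : Prop :=
  (forall x y, q (x [+] y) <= q x + q y) /\ (forall t x, 0 <= t -> q (t [*] x) = t * q x).

Lemma sublinear_0 q : sublinear q -> q (v0 E) = 0.
Proof. intros [_ Hscal]. rewrite <- (vscal_0l (v0 E)), Hscal by lra. ring. Qed.

Lemma sublinear_opp q x : sublinear q -> - q ((-1) [*] x) <= q x.
Proof.
  intros Hq. pose proof (proj1 Hq x ((-1) [*] x)) as H.
  rewrite vadd_opp, (sublinear_0 q Hq) in H. lra.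
Qed.

Lemma sublinear_infimum {I : Type} (F : I -> E -> R) (lb : E -> R) (i0 : I) :
  (forall i x, lb x <= F i x) ->
  (forall i j x y, exists k, F k (x [+] y) <= F i x + F j y) ->
  (forall i t x, 0 < t -> exists k, F k (t [*] x) <= t * F i x) ->
  (forall i, F i (v0 E) = 0) ->
  exists q, sublinear q /\ forall i x, q x <= F i x.
Proof.
  intros Hlb Fadd Fscal F0.
  destruct (boolp.choice (P := fun x r => (forall c, (forall i, c <= F i x) -> c <= r) /\
                                          (forall i, r <= F i x))) as [q Hq].
  { intros x. destruct (separating_real (fun c => forall i, c <= F i x)
                          (fun t => exists i, t = F i x)) as [r [lower upper]].
    - now exists (lb x).
    - now exists (F i0 x), i0.
    - intros c t Hc [i ->]. apply Hc.
    - exists r. split; [exact lower|]. intros i. apply upper. now exists i. }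
  exists q. split; [|intros i x; apply Hq].
  assert (scal_le : forall t x, 0 < t -> q (t [*] x) <= t * q x).
  { intros t x Ht. apply Rmult_le_reg_l with (/ t); [now apply Rinv_0_lt_compat|].
    rewrite <- Rmult_assoc, Rinv_l, Rmult_1_l by lra. apply Hq. intros i.
    destruct (Fscal i t x Ht) as [k Hk]. apply Rmult_le_reg_l with t; [exact Ht|].
    rewrite <- Rmult_assoc, Rinv_r, Rmult_1_l by lra.
    apply Rle_trans with (2 := Hk). apply Hq. }
  split.
  - intros x y. enough (q (x [+] y) - q y <= q x) by lra. apply Hq. intros i.
    enough (q (x [+] y) - F i x <= q y) by lra. apply Hq. intros j.
    destruct (Fadd i j x y) as [k Hk]. pose proof (proj2 (Hq (x [+] y)) k). lra.
  - intros t x [Ht| <-].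
    + apply Rle_antisym; [now apply scal_le|].
      pose proof (Rinv_0_lt_compat t Ht) as Hi. pose proof (scal_le (/ t) (t [*] x) Hi) as H.
      rewrite vscalA, Rinv_l, vscal1 in H by lra.
      apply Rmult_le_compat_l with (r := t) in H; [|lra].
      rewrite <- Rmult_assoc, Rinv_r, Rmult_1_l in H by lra. exact H.
    + rewrite vscal_0l, Rmult_0_l. apply Rle_antisym.
      * rewrite <- (F0 i0). apply Hq.
      * apply Hq. intros i. rewrite F0. lra.
Qed.

(* The witness is [x |-> inf_{t >= 0} (q (x + t y) - t q y)]. *)
Lemma sublinear_bend q y :
  sublinear q ->
  exists p, sublinear p /\ (forall x, p x <= q x) /\ forall x, p x <= q (x [+] y) - q y.
Proof.
  intros Hq. pose proof Hq as [Hadd Hscal].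
  destruct (sublinear_infimum (fun (t : {t : R | 0 <= t}) x =>
              q (x [+] proj1_sig t [*] y) - proj1_sig t * q y)
              (fun x => - q ((-1) [*] x)) (exist _ 0 (Rle_refl 0))) as [p [Hp p_le]].
  - intros [t Ht] x. simpl. rewrite <- (Hscal t y Ht).
    pose proof (Hadd (x [+] t [*] y) ((-1) [*] x)) as H.
    rewrite (vaddC E x), <- vaddA, vadd_opp, vadd0, (vaddC E _ x) in H. lra.
  - intros [t Ht] [s Hs] x z. simpl. exists (exist _ (t + s) (Rplus_le_le_0_compat t s Ht Hs)).
    simpl. rewrite vscalDl, vadd_swap.
    pose proof (Hadd (x [+] t [*] y) (z [+] s [*] y)). lra.
  - intros [s Hs] t x Ht. simpl.
    exists (exist _ (t * s) (Rmult_le_pos t s (Rlt_le _ _ Ht) Hs)). simpl.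
    rewrite <- vscalA, <- vscalDr, Hscal by lra. lra.
  - intros [t Ht]. simpl. rewrite vadd_0l, Hscal by exact Ht. ring.
  - exists p. split; [exact Hp|]. split; intros x.
    + pose proof (p_le (exist _ 0 (Rle_refl 0)) x) as H. simpl in H.
      rewrite vscal_0l, vadd0 in H. lra.
    + pose proof (p_le (exist _ 1 Rle_0_1) x) as H. simpl in H. rewrite vscal1 in H. lra.
Qed.

Lemma sublinear_minimal p :
  sublinear p ->
  exists q, sublinear q /\ (forall x, q x <= p x) /\
    forall r, sublinear r -> (forall x, r x <= q x) -> forall x, q x <= r x.
Proof.
  intros Hp.
  set (below := {q : E -> R | sublinear q /\ forall x, q x <= p x}).
  set (ge := fun q r : below => boolp.asbool (forall x, proj1_sig r x <= proj1_sig q x)).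
  assert (geP : forall q r, is_true (ge q r) <-> forall x, proj1_sig r x <= proj1_sig q x).
  { intros q r. unfold ge. now rewrite boolp.asboolE. }
  destruct (@classical_sets.ZL_preorder below (exist _ p (conj Hp (fun x => Rle_refl _))) ge)
    as [[q [Hq qp]] Hmin].
  - intros q. apply geP. intros x. lra.
  - intros q r s qr rs. apply geP. rewrite geP in qr, rs. intros x.
    specialize (qr x). specialize (rs x). lra.
  - intros A Achain. destruct (classic (exists q, A q)) as [[q0 Aq0]|Aempty].
    + destruct (sublinear_infimum (fun q : {q | A q} => proj1_sig (proj1_sig q))
                  (fun x => - p ((-1) [*] x)) (exist _ q0 Aq0)) as [g [Hg g_le]].
      * intros [[q [Hq qp]] Aq] x. simpl. pose proof (sublinear_opp q x Hq).
        pose proof (qp ((-1) [*] x)). lra.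
      * intros [q Aq] [r Ar] x y. simpl.
        destruct (Achain q r Aq Ar) as [H|H]; rewrite geP in H.
        -- exists (exist _ r Ar). simpl.
           pose proof (proj1 (proj1 (proj2_sig r)) x y). specialize (H x). lra.
        -- exists (exist _ q Aq). simpl.
           pose proof (proj1 (proj1 (proj2_sig q)) x y). specialize (H y). lra.
      * intros [[q [Hq qp]] Aq] t x Ht. exists (exist _ (exist _ q (conj Hq qp)) Aq). simpl.
        right. apply Hq. lra.
      * intros [[q [Hq qp]] Aq]. now apply sublinear_0.
      * exists (exist _ g (conj Hg (fun x =>
          Rle_trans _ _ _ (g_le (exist _ q0 Aq0) x) (proj2 (proj2_sig q0) x)))).
        intros q Aq. apply geP. exact (g_le (exist _ q Aq)).
    + exists (exist _ p (conj Hp (fun x => Rle_refl _))). intros q Aq.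
      destruct Aempty. now exists q.
  - exists q. split; [exact Hq|]. split; [exact qp|]. intros r Hr rq.
    assert (rp : forall x, r x <= p x) by (intros x; apply Rle_trans with (1 := rq x); auto).
    apply (geP (exist _ r (conj Hr rp)) (exist _ q (conj Hq qp))), Hmin, geP. exact rq.
Qed.

Lemma sublinear_minimal_linear q :
  sublinear q -> (forall r, sublinear r -> (forall x, r x <= q x) -> forall x, q x <= r x) ->
  is_linear q.
Proof.
  intros Hq Hmin.
  assert (q_add : forall x y, q (x [+] y) = q x + q y).
  { intros x y. apply Rle_antisym; [apply Hq|].
    destruct (sublinear_bend q y Hq) as [r [Hr [rq r_bend]]].
    pose proof (Hmin r Hr rq x). specialize (r_bend x). lra. }
  split; [exact q_add|]. intros c x. destruct (Rle_dec 0 c) as [Hc|Hc]; [now apply Hq|].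
  pose proof (q_add (c [*] x) ((- c) [*] x)) as H.
  rewrite <- vscalDl, Rplus_opp_r, vscal_0l, (sublinear_0 q Hq), (proj2 Hq (- c)) in H by lra.
  lra.
Qed.

(* The functional is minimal below the bending of [p] along [x0], so that
   [q (- x0) <= p 0 - p x0]. *)
Lemma hahn_banach p x0 :
  sublinear p -> exists q, is_linear q /\ (forall x, q x <= p x) /\ q x0 = p x0.
Proof.
  intros Hp. destruct (sublinear_bend p x0 Hp) as [p' [Hp' [p'_le p'_bend]]].
  destruct (sublinear_minimal p' Hp') as [q [Hq [q_le q_min]]].
  pose proof (sublinear_minimal_linear q Hq q_min) as [q_add q_scal].
  assert (qp : forall x, q x <= p x) by (intros x; apply Rle_trans with (p' x); auto).
  exists q. split; [now split|]. split; [exact qp|]. apply Rle_antisym; [apply qp|].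
  pose proof (Rle_trans _ _ _ (q_le ((-1) [*] x0)) (p'_bend ((-1) [*] x0))) as H.
  rewrite q_scal, vaddC, vadd_opp, (sublinear_0 p Hp) in H. lra.
Qed.

Lemma norming_functional n x : exists f, dual_ball n 1 f /\ ev f x = maxsem n x.
Proof.
  destruct (hahn_banach (maxsem n) x) as [q [q_linear [q_le qx]]].
  { split; [apply maxsem_triangle|]. intros t y Ht. now rewrite maxsem_homog, Rabs_pos_eq. }
  destruct (bounded_linear_in_dual_ball q n 1 q_linear) as [f [Bf fq]].
  - intros y. rewrite Rmult_1_l. apply Rabs_le. split; [|apply q_le].
    pose proof (q_le ((-1) [*] y)) as H.
    rewrite (proj2 q_linear), maxsem_homog, Rabs_m1 in H. lra.
  - exists f. split; [exact Bf|]. now rewrite fq.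
Qed.

Lemma dual_separates_points x : (forall f, ev f x = 0) -> x = v0 E.
Proof.
  intros Hx. apply sem_separating. intros n. apply Rle_antisym; [|apply sem_ge0].
  destruct (norming_functional n x) as [f [_ fx]]. rewrite <- (Hx f), fx.
  now apply sem_le_maxsem.
Qed.

Lemma weak_regular : regular_space E (weak_open E).
Proof.
  split.
  - intros x y yx.
    destruct (not_all_ex_not _ (fun f => ev f (vsub y x) = 0)) as [f Hf].
    { intros H. apply yx, vsub_eq0, dual_separates_points, H. }
    rewrite ev_sub in Hf. apply Rabs_pos_lt in Hf.
    apply filterS with (2 := weak_nbhd_ev y f _ Hf). intros z Hz ->.
    rewrite Rabs_minus_sym in Hz. lra.
  - intros C x HC Cx. destruct (HC x Cx) as [L [r [Hr H]]].
    exists (fun y => forall f, In f L -> Rabs (ev f y - ev f x) < r / 2).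
    exists (fun y => exists i : {f | In f L},
                r / 2 < Rabs (ev (proj1_sig i) y - ev (proj1_sig i) x)).
    split; [|split; [|split; [|split]]].
    + apply weak_open_forall_In. intros f _. apply weak_open_dist_lt.
    + apply weak_open_exists. intros f. apply weak_open_dist_gt.
    + intros f _. rewrite Rminus_diag, Rabs_R0. lra.
    + intros y Cy. apply NNPP. intros Hno. apply (H y); [|exact Cy]. intros f Hf.
      rewrite ev_sub. apply Rnot_le_lt. intros Hle. apply Hno. exists (exist _ f Hf). simpl. lra.
    + intros y [near [[f Hf] far]]. specialize (near f Hf). simpl in far. lra.
Qed.

(** * Weakly bounded sets are bounded *)

Lemma norming_perturbation n w x f :
  0 <= w -> exists g, (forall y, Rabs (ev g y - ev f y) <= w * maxsem n y) /\
                      w * maxsem n x <= Rabs (ev g x).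
Proof.
  intros Hw. destruct (norming_functional n x) as [h [Bh hx]].
  assert (bound : forall s y, Rabs s = w ->
            Rabs (ev (dual_axpy s f h) y - ev f y) <= w * maxsem n y).
  { intros s y Hs. rewrite ev_axpy.
    replace (ev f y + s * ev h y - ev f y) with (s * ev h y) by ring.
    rewrite Rabs_mult, Hs. apply Rmult_le_compat_l; [exact Hw|].
    specialize (Bh y). lra. }
  pose proof (Rmult_le_pos w _ Hw (maxsem_ge0 n x)) as wx.
  destruct (Rle_dec 0 (ev f x)) as [fx|fx].
  - exists (dual_axpy w f h). split; [intros y; apply bound; now apply Rabs_pos_eq|].
    rewrite ev_axpy, hx, Rabs_pos_eq; lra.
  - exists (dual_axpy (- w) f h).
    split; [intros y; apply bound; rewrite Rabs_Ropp; now apply Rabs_pos_eq|].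
    rewrite ev_axpy, hx, Rabs_left; lra.
Qed.

(* Gliding hump: the [k]-th perturbation, of size [3^-k], makes the functional large at
   [x k], and all the later ones together are only half as large. *)
Lemma weakly_bounded_bounded K :
  (forall f, exists M, forall x, K x -> Rabs (ev f x) <= M) -> E_bounded K.
Proof.
  intros HK n. apply NNPP. intros unbounded.
  set (w := fun k => (/ 3) ^ k).
  assert (w_pos : forall k, 0 < w k) by (intros k; apply pow_lt; lra).
  destruct (boolp.choice (P := fun k x => K x /\ INR k < / 2 * w k * maxsem n x)) as [x Hx].
  { intros k. apply NNPP. intros Hno. apply unbounded. exists (2 * INR k / w k).
    intros y Ky. apply Rnot_lt_le. intros Hy. apply Hno. exists y. split; [exact Ky|].
    apply Rlt_le_trans with (r3 := maxsem n y) in Hy; [|now apply sem_le_maxsem].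
    apply Rmult_lt_compat_l with (r := / 2 * w k) in Hy; [|specialize (w_pos k); lra].
    replace (/ 2 * w k * (2 * INR k / w k)) with (INR k) in Hy; [exact Hy|].
    field. specialize (w_pos k). lra. }
  destruct (boolp.choice (fun kf : nat * dual =>
              norming_perturbation n (w (fst kf)) (x (fst kf)) (snd kf) (Rlt_le _ _ (w_pos _))))
    as [next Hnext].
  set (s := fix s k := match k with O => dual_zero | S k' => next (k', s k') end).
  destruct (dual_telescoping_limit n s (fun k => 3 / 2 * w k)) as [f Hf].
  - intros k. specialize (w_pos k). lra.
  - intros k y. apply Rle_trans with (1 := proj1 (Hnext (k, s k)) y). simpl.
    unfold w. simpl. right. field.
  - destruct (HK f) as [M HM]. destruct (INR_unbounded M) as [k Hk].
    destruct (Hx k) as [Kx large]. specialize (HM (x k) Kx).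
    specialize (Hf (S k) (x k)). pose proof (proj2 (Hnext (k, s k))) as hump.
    change (next (k, s k)) with (s (S k)) in hump. cbn [fst] in hump.
    replace (3 / 2 * w (S k)) with (/ 2 * w k) in Hf by (unfold w; simpl; field).
    pose proof (Rabs_triang (ev f (x k)) (- (ev f (x k) - ev (s (S k)) (x k)))) as T.
    replace (ev f (x k) + - (ev f (x k) - ev (s (S k)) (x k))) with (ev (s (S k)) (x k)) in T
      by ring.
    rewrite Rabs_Ropp in T. lra.
Qed.

Lemma weakly_compact_bounded K : compact E (weak_open E) K -> E_bounded K.
Proof.
  intros HK. apply weakly_bounded_bounded. intros f.
  destruct (compact_increasing_cover K (fun n x => Rabs (ev f x - 0) < INR n) HK) as [n Hn].
  - intros n. apply weak_open_dist_lt.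
  - intros m n x Hmn Hx. apply Rlt_le_trans with (1 := Hx). now apply le_INR.
  - intros x _. destruct (INR_unbounded (Rabs (ev f x - 0))) as [n Hn]. now exists n.
  - exists (INR n). intros x Kx. specialize (Hn x Kx). rewrite Rminus_0_r in Hn. lra.
Qed.

(** * Sequences equivalent to the unit vector basis of l1 *)

Definition vconv (u : nat -> E) (l : E) : Prop :=
  forall n eps, 0 < eps -> eventually (fun i => sem n (vsub (u i) l) < eps).

Lemma vconv_maxsem u l n eps :
  vconv u l -> 0 < eps -> eventually (fun i => maxsem n (vsub (u i) l) < eps).
Proof.
  intros Hu Heps. induction n as [|n IH]; [now apply Hu|].
  apply filterS with (2 := filterI IH (Hu (S n) eps Heps)).
  intros i [Hn HS]. now apply Rmax_lub_lt.
Qed.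

Lemma vconv_maxsem_tends_to u l n :
  vconv u l -> tends_to eventually (fun i => maxsem n (u i)) (maxsem n l).
Proof.
  intros Hu eps Heps. apply filterS with (2 := vconv_maxsem u l n eps Hu Heps). intros i ui.
  pose proof (maxsem_triangle n (vsub (u i) l) l) as T. rewrite vsub_addK in T.
  pose proof (maxsem_triangle n (vsub l (u i)) (u i)) as T'.
  rewrite vsub_addK, vsub_opp, maxsem_homog, Rabs_m1 in T'. apply Rabs_def1; lra.
Qed.

Lemma vconv_unique u l k : vconv u l -> vconv u k -> l = k.
Proof.
  intros Hl Hk. apply vsub_eq0, sem_separating. intros n.
  apply Rle_antisym; [|apply sem_ge0]. apply Rle_plus_epsilon. intros eps Heps.
  destruct (filter_ex (F := eventually) (filterI (F := eventually)
    (Hl n (eps / 2) ltac:(lra)) (Hk n (eps / 2) ltac:(lra)))) as [i [ul uk]].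
  pose proof (sem_sub_triangle n l (u i) k) as T. rewrite (sem_sub_sym n l (u i)) in T. lra.
Qed.

Lemma vconv_add u v l k : vconv u l -> vconv v k -> vconv (fun i => u i [+] v i) (l [+] k).
Proof.
  intros Hu Hv n eps Heps.
  apply filterS with (2 := filterI (F := eventually)
    (Hu n (eps / 2) ltac:(lra)) (Hv n (eps / 2) ltac:(lra))).
  intros i [ui vi]. rewrite vsub_add.
  apply Rle_lt_trans with (1 := sem_triangle _ _ _ _). lra.
Qed.

Lemma vconv_scal u c l : vconv u l -> vconv (fun i => c [*] u i) (c [*] l).
Proof.
  intros Hu n eps Heps. pose proof (Rabs_pos c).
  apply filterS with (2 := Hu n (eps / (Rabs c + 1)) ltac:(apply Rdiv_lt_0_compat; lra)).
  intros i ui. rewrite vsub_scal, sem_homog. pose proof (sem_ge0 n (vsub (u i) l)).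
  apply Rmult_lt_compat_l with (r := Rabs c + 1) in ui; [|lra].
  replace ((Rabs c + 1) * (eps / (Rabs c + 1))) with eps in ui by (field; lra). lra.
Qed.

Fixpoint lin_sum (a : nat -> R) (b : nat -> E) (n : nat) : E :=
  match n with
  | O => a O [*] b O
  | S k => lin_sum a b k [+] a (S k) [*] b (S k)
  end.

Lemma lin_sum_add a a' b n :
  lin_sum (fun k => a k + a' k) b n = lin_sum a b n [+] lin_sum a' b n.
Proof.
  induction n as [|n IH]; simpl; rewrite ?IH, vscalDl; [reflexivity|apply vadd_swap].
Qed.

Lemma lin_sum_scal c a b n : lin_sum (fun k => c * a k) b n = c [*] lin_sum a b n.
Proof. induction n as [|n IH]; simpl; rewrite ?IH, ?vscalDr, <- vscalA; reflexivity. Qed.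

Lemma ev_lin_sum f a b n : ev f (lin_sum a b n) = sum_f_R0 (fun k => a k * ev f (b k)) n.
Proof. induction n as [|n IH]; simpl; rewrite ?ev_add, ev_scal, ?IH; reflexivity. Qed.

Lemma maxsem_lin_sum_le a b n M N :
  (forall k, maxsem n (b k) <= M) ->
  maxsem n (lin_sum a b N) <= M * sum_f_R0 (fun k => Rabs (a k)) N.
Proof.
  intros HM.
  assert (term : forall k, maxsem n (a k [*] b k) <= M * Rabs (a k)).
  { intros k. rewrite maxsem_homog, Rmult_comm.
    apply Rmult_le_compat_r; [apply Rabs_pos|auto]. }
  induction N as [|N IH]; simpl; [apply term|].
  apply Rle_trans with (1 := maxsem_triangle _ _ _). rewrite Rmult_plus_distr_l.
  apply Rplus_le_compat; auto.
Qed.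

Lemma sem_lin_sum_sub_le a b n M j d :
  (forall k, sem n (b k) <= M) ->
  sem n (vsub (lin_sum a b (d + j)) (lin_sum a b j)) <=
    M * (sum_f_R0 (fun k => Rabs (a k)) (d + j) - sum_f_R0 (fun k => Rabs (a k)) j).
Proof.
  intros HM. induction d as [|d IH]; simpl.
  - rewrite vsub_self, sem_0. right. ring.
  - unfold vsub in *. rewrite <- vaddA, (vaddC E (_ [*] _)), vaddA.
    apply Rle_trans with (1 := sem_triangle _ _ _ _). rewrite sem_homog.
    pose proof (Rabs_pos (a (S (d + j)))). specialize (HM (S (d + j))). nra.
Qed.

Lemma lin_sum_vconv a b :
  E_bounded (fun x => exists k, x = b k) -> summable a -> exists l, vconv (lin_sum a b) l.
Proof.
  intros Hb [s Hs]. apply (complete E). intros n eps Heps. fold (@vsub E).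
  destruct (Hb n) as [M0 HM0]. set (M := Rabs M0 + 1).
  assert (M_pos : 0 < M) by (unfold M; pose proof (Rabs_pos M0); lra).
  assert (HM : forall k, sem n (b k) <= M).
  { intros k. specialize (HM0 (b k) (ex_intro _ k eq_refl)).
    unfold M. pose proof (Rle_abs M0). lra. }
  destruct (Hs (eps / (2 * M))) as [N HN]; [apply Rdiv_lt_0_compat; lra|].
  assert (ordered : forall i j, (N <= j)%nat -> (j <= i)%nat ->
            sem n (vsub (lin_sum a b i) (lin_sum a b j)) < eps).
  { intros i j Hj Hi. replace i with ((i - j) + j)%nat by lia.
    apply Rle_lt_trans with (1 := sem_lin_sum_sub_le a b n M j (i - j) HM).
    pose proof (HN j Hj) as sj. pose proof (HN (i - j + j)%nat ltac:(lia)) as si.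
    apply Rabs_def2 in sj, si.
    replace eps with (M * (2 * (eps / (2 * M)))) by (field; lra).
    apply Rmult_lt_compat_l; lra. }
  exists N. intros i j Hi Hj. change (sem n (vsub (lin_sum a b i) (lin_sum a b j)) < eps).
  destruct (Nat.le_ge_cases j i) as [Hij|Hij]; [now apply ordered|].
  rewrite sem_sub_sym. now apply ordered.
Qed.

Definition independent_on_ball n c r e (b : nat -> E) : Prop :=
  forall N (M : nat -> bool), exists f, dual_ball n c f /\
    forall k, (k < N)%nat -> if M k then e <= ev f (b k) else ev f (b k) <= r.

(* Rosenthal's estimate: with [f] adapted to the positive part of [a] and [g] to its
   complement, every term of [(f - g) (sum a_k b_k)] is at least [(e - r) |a_k|]. *)
Lemma independent_l1_lower_bound n c r e b a N :
  r < e -> independent_on_ball n c r e b ->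
  (e - r) * sum_f_R0 (fun k => Rabs (a k)) N <= 2 * c * maxsem n (lin_sum a b N).
Proof.
  intros re Hb.
  destruct (Hb (S N) (fun k => if Rlt_dec 0 (a k) then true else false)) as [f [Bf Hf]].
  destruct (Hb (S N) (fun k => if Rlt_dec 0 (a k) then false else true)) as [g [Bg Hg]].
  apply Rle_trans with (ev f (lin_sum a b N) - ev g (lin_sum a b N)).
  - rewrite !ev_lin_sum, <- minus_sum, scal_sum. apply sum_Rle. intros k Hk.
    specialize (Hf k ltac:(lia)). specialize (Hg k ltac:(lia)).
    destruct (Rlt_dec 0 (a k)) as [ak|ak].
    + rewrite Rabs_pos_eq by lra. nra.
    + rewrite Rabs_left1 by lra. nra.
  - specialize (Bf (lin_sum a b N)). specialize (Bg (lin_sum a b N)).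
    apply Rabs_le_between in Bf, Bg. lra.
Qed.

Lemma abs_sum_le_infinite_sum (a : nat -> R) s N :
  infinite_sum (fun k => Rabs (a k)) s -> sum_f_R0 (fun k => Rabs (a k)) N <= s.
Proof.
  intros Hs. apply (sum_incr (fun k => Rabs (a k))); [exact Hs|intros; apply Rabs_pos].
Qed.

Lemma summable_add a a' : summable a -> summable a' -> summable (fun k => a k + a' k).
Proof.
  intros [s Hs] [t Ht].
  destruct (Rseries_CV_comp (fun k => Rabs (a k + a' k)) (fun k => Rabs (a k) + Rabs (a' k)))
    as [l Hl].
  - intros k. split; [apply Rabs_pos|apply Rabs_triang].
  - exists (s + t). intros eps Heps.
    apply filterS with (2 := tends_to_plus (F := eventually) _ _ _ _ Hs Ht eps Heps).
    intros k. now rewrite sum_plus.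
  - now exists l.
Qed.

Lemma summable_scal c a : summable a -> summable (fun k => c * a k).
Proof.
  intros [s Hs]. exists (Rabs c * s). intros eps Heps.
  apply filterS with (2 := tends_to_scal (F := eventually) _ (Rabs c) _ Hs eps Heps).
  intros k. rewrite scal_sum. unfold Rdist.
  now rewrite (sum_eq (fun i => Rabs (c * a i)) (fun i => Rabs (a i) * Rabs c))
    by (intros i _; rewrite Rabs_mult; ring).
Qed.

Lemma contains_l1_of_independent b n c r e :
  r < e -> 0 <= c -> E_bounded (fun x => exists k, x = b k) ->
  independent_on_ball n c r e b -> contains_l1 E.
Proof.
  intros re Hc Hb Hindep.
  destruct (choice_on (v0 E) summable (fun a x => vconv (lin_sum a b) x)) as [T HT].
  { intros a. now apply lin_sum_vconv. }
  exists T. split; [|split; [|split]].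
  - intros a a' Sa Sa'. apply vconv_unique with (1 := HT _ (summable_add _ _ Sa Sa')).
    intros m eps Heps. apply filterS with (2 := vconv_add _ _ _ _ (HT a Sa) (HT a' Sa') m eps Heps).
    intros i. now rewrite lin_sum_add.
  - intros s a Sa. apply vconv_unique with (1 := HT _ (summable_scal s a Sa)).
    intros m eps Heps. apply filterS with (2 := vconv_scal _ s _ (HT a Sa) m eps Heps).
    intros i. now rewrite lin_sum_scal.
  - intros m. destruct (maxsem_bounded_on _ m Hb) as [M HM]. exists M. intros a l Hl.
    apply Rle_trans with (maxsem m (T a)); [now apply sem_le_maxsem|].
    apply (tends_to_le (F := eventually)) with
      (2 := vconv_maxsem_tends_to _ _ m (HT a (ex_intro _ l Hl))).
    apply filterS with (2 := filterT). intros N _.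
    assert (HMb : forall k, maxsem m (b k) <= M) by (intros k; apply HM; now exists k).
    apply Rle_trans with (1 := maxsem_lin_sum_le a b m M N HMb).
    apply Rmult_le_compat_l; [|now apply abs_sum_le_infinite_sum].
    apply Rle_trans with (2 := HMb O). apply maxsem_ge0.
  - exists n, ((2 * c + 1) / (e - r)). split; [apply Rdiv_lt_0_compat; lra|]. intros a l Hl.
    assert (lower : (e - r) * l + - (2 * c) * maxsem n (T a) <= 0).
    { apply (tends_to_le (F := eventually)) with (2 := tends_to_plus _ _ _ _
        (tends_to_scal _ (e - r) _ Hl)
        (tends_to_scal _ (- (2 * c)) _ (vconv_maxsem_tends_to _ _ n (HT a (ex_intro _ l Hl))))).
      apply filterS with (2 := filterT). intros N _.
      pose proof (independent_l1_lower_bound n c r e b a N re Hindep). lra. }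
    apply Rmult_le_reg_l with (e - r); [lra|].
    replace ((e - r) * ((2 * c + 1) / (e - r) * maxsem n (T a)))
      with ((2 * c + 1) * maxsem n (T a)) by (field; lra).
    pose proof (maxsem_ge0 n (T a)). lra.
Qed.

(** * Weakly null sequences chosen from bounded sets *)

Section Game.
Variables (U : (E -> Prop) -> Prop) (UU : UltraFilter U).

(* Player I plays sets of the ultrafilter [U], player II elements [b k] of them; player I
   can prevent every [f] in [C] from satisfying [e <= f (b k)] infinitely often. *)
Definition avoidable (e : R) (C : dual -> Prop) : Prop :=
  exists strat, (forall l, U (strat l)) /\
    forall b, follows strat b -> forall f, C f -> eventually (fun k => ev f (b k) < e).

Lemma avoidable_subset e (C D : dual -> Prop) :
  (forall f, C f -> D f) -> avoidable e D -> avoidable e C.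
Proof. intros CD [strat [stratU Hstrat]]. exists strat. split; [exact stratU|]. eauto. Qed.

Lemma avoidable_empty e (C : dual -> Prop) : (forall f, ~ C f) -> avoidable e C.
Proof.
  intros HC. exists (fun _ _ => True). split; [intros _; apply filterT|].
  intros b _ f Cf. now destruct (HC f).
Qed.

Lemma avoidable_union e (C D : dual -> Prop) :
  avoidable e C -> avoidable e D -> avoidable e (fun f => C f \/ D f).
Proof.
  intros [s [sU Hs]] [t [tU Ht]]. exists (fun l x => s l x /\ t l x). split.
  - intros l. now apply filterI.
  - intros b Hb f [Cf|Df]; [apply (Hs b)|apply (Ht b)]; try (intros k; apply Hb); assumption.
Qed.

Lemma avoidable_list_union {I : Type} e (C : I -> dual -> Prop) (L : list I) :
  (forall i, In i L -> avoidable e (C i)) -> avoidable e (fun f => exists i, In i L /\ C i f).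
Proof.
  induction L as [|i L IH]; intros H.
  - apply avoidable_empty. intros f [i [[] _]].
  - apply avoidable_subset with (fun f => C i f \/ exists j, In j L /\ C j f).
    + intros f [j [[<-|Hj] Cf]]; [now left|]. right. now exists j.
    + apply avoidable_union; [apply H; now left|]. apply IH. intros j Hj. apply H. now right.
Qed.

(* After the [i]-th move of player II, player I also starts, from the position reached, a
   strategy for the functionals with [e <= f (b i)]. *)
Lemma avoidable_of_superlevels e (C : dual -> Prop) :
  U (fun x => avoidable e (fun f => e <= ev f x /\ C f)) -> avoidable e C.
Proof.
  intros HV. set (V := fun x => _) in HV.
  destruct (choice_on (fun _ _ => True) V (fun x strat => (forall l, U (strat l)) /\
              forall b, follows strat b -> forall f, e <= ev f x /\ C f ->
                eventually (fun k => ev f (b k) < e)) (fun x Vx => Vx)) as [strat Hstrat].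
  set (next := fun p => match rev p with nil => fun _ => V
                        | x :: _ => fun t y => V x -> strat x t y end).
  exists (merge next). split.
  - intros l. apply filter_merge; [typeclasses eauto|]. intros p t. unfold next.
    destruct (rev p) as [|x _]; [exact HV|].
    destruct (classic (V x)) as [Vx|Vx].
    + apply filterS with (2 := proj1 (Hstrat x Vx) t). intros y Hy _. exact Hy.
    + apply filterS with (2 := filterT). intros y _ Vx'. contradiction.
  - intros b Hb f Cf. destruct (classic (exists i, e <= ev f (b i))) as [[i Hi]|Hno].
    + assert (Vb : V (b i)) by exact (follows_merge _ _ O Hb i).
      apply (eventually_shift (S i)). apply (proj2 (Hstrat (b i) Vb)); [|now split].
      pose proof (follows_merge _ _ (S i) Hb) as H. unfold next in H.
      rewrite hist_S, rev_app_distr in H. intros k. now apply H.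
    + exists O. intros k _. apply Rnot_le_lt. intros Hk. apply Hno. now exists k.
Qed.

Hypothesis U_weakly_null : forall W, weak_nbhd (v0 E) W -> U W.

Lemma avoidable_of_sublevels e n c r (C : dual -> Prop) :
  0 < r -> (forall f, C f -> dual_ball n c f) ->
  U (fun x => avoidable e (fun f => ev f x <= r /\ C f)) -> avoidable e C.
Proof.
  intros Hr CB HV. set (V := fun x => _) in HV.
  destruct (dual_ball_finite_subcover n c (fun x : {x | V x} => proj1_sig x) (fun _ => r))
    as [L HL].
  - intros f _.
    destruct (filter_ex (filterI HV (U_weakly_null _ (weak_nbhd_ev (v0 E) f r Hr))))
      as [x [Vx fx]].
    exists (exist _ x Vx). simpl. rewrite ev_0, Rminus_0_r in fx. apply Rabs_def2 in fx. lra.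
  - apply avoidable_subset with
      (fun f => exists i, In i L /\ ev f (proj1_sig i) <= r /\ C f).
    + intros f Cf. destruct (HL f (CB f Cf)) as [i [Li fi]]. exists i.
      split; [exact Li|]. split; [lra|exact Cf].
    + apply (avoidable_list_union e (fun i f => ev f (proj1_sig i) <= r /\ C f)).
      intros i _. exact (proj2_sig i).
Qed.

Definition refine (r e : R) (Cs : list (dual -> Prop)) (x : E) : list (dual -> Prop) :=
  flat_map (fun C => (fun f => e <= ev f x /\ C f) :: (fun f => ev f x <= r /\ C f) :: nil) Cs.

Definition unavoidable_in_ball n c e (Cs : list (dual -> Prop)) : Prop :=
  forall C, In C Cs -> (forall f, C f -> dual_ball n c f) /\ ~ avoidable e C.

Lemma unavoidable_refine n c r e B (Cs : list (dual -> Prop)) :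
  0 < r -> U B -> unavoidable_in_ball n c e Cs ->
  exists x, B x /\ unavoidable_in_ball n c e (refine r e Cs x).
Proof.
  intros Hr UB HCs.
  assert (Usplit : U (fun x => forall C, In C Cs ->
            ~ avoidable e (fun f => e <= ev f x /\ C f) /\
            ~ avoidable e (fun f => ev f x <= r /\ C f))).
  { apply filter_forall_In. intros C HC. destruct (HCs C HC) as [CB C_unavoidable].
    apply filterI; apply ultrafilter_not; contradict C_unavoidable.
    - now apply avoidable_of_superlevels.
    - now apply avoidable_of_sublevels with n c r. }
  destruct (filter_ex (filterI UB Usplit)) as [x [Bx Hx]]. exists x. split; [exact Bx|].
  intros D HD. apply in_flat_map in HD. destruct HD as [C [HC HD]].
  destruct (HCs C HC) as [CB _]. destruct (Hx C HC) as [Hge Hle].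
  destruct HD as [<-|[<-|[]]]; (split; [|assumption]); intros f [_ Cf]; now apply CB.
Qed.

Lemma independent_of_unavoidable n c r e B :
  0 < r -> U B -> ~ avoidable e (dual_ball n c) ->
  exists b, (forall k, B (b k)) /\ independent_on_ball n c r e b.
Proof.
  intros Hr UB Hball.
  set (cells := fun p => fold_left (refine r e) p (dual_ball n c :: nil)).
  destruct (follows_exists (fun p x => unavoidable_in_ball n c e (cells p) ->
              B x /\ unavoidable_in_ball n c e (cells (p ++ x :: nil)))) as [b Hb].
  { intros p. destruct (classic (unavoidable_in_ball n c e (cells p))) as [Hp|Hp].
    - destruct (unavoidable_refine n c r e B (cells p) Hr UB Hp) as [x [Bx Hx]].
      exists x. intros _. split; [exact Bx|]. unfold cells. now rewrite fold_left_app.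
    - exists (v0 E). tauto. }
  assert (Hcells : forall k, unavoidable_in_ball n c e (cells (hist b k))).
  { induction k as [|k IH].
    - intros C [<-|[]]. split; [auto|exact Hball].
    - rewrite hist_S. now apply Hb. }
  exists b. split; [intros k; now apply Hb|]. intros N M.
  assert (cell : exists C, In C (cells (hist b N)) /\ forall f, C f ->
            forall k, (k < N)%nat -> if M k then e <= ev f (b k) else ev f (b k) <= r).
  { induction N as [|N [C [HC Csigns]]].
    - exists (dual_ball n c). split; [now left|]. intros f _ k Hk. lia.
    - exists (fun f => (if M N then e <= ev f (b N) else ev f (b N) <= r) /\ C f). split.
      + rewrite hist_S. unfold cells. rewrite fold_left_app.
        apply in_flat_map. exists C. split; [exact HC|].
        destruct (M N); [now left|right; now left].
      + intros f [signN Cf] k Hk. destruct (Nat.eq_dec k N) as [->|Hne]; [exact signN|].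
        apply Csigns; [exact Cf|lia]. }
  destruct cell as [C [HC Csigns]]. destruct (Hcells N C HC) as [CB C_unavoidable].
  apply NNPP. intros Hno. apply C_unavoidable, avoidable_empty. intros f Cf.
  apply Hno. exists f. split; [now apply CB|now apply Csigns].
Qed.

Lemma dual_ball_avoidable B n c e :
  ~ contains_l1 E -> E_bounded B -> U B -> 0 <= c -> 0 < e -> avoidable e (dual_ball n c).
Proof.
  intros no_l1 HB UB Hc He. apply NNPP. intros Hball. apply no_l1.
  destruct (independent_of_unavoidable n c (e / 2) e B ltac:(lra) UB Hball) as [b [Bb Hb]].
  apply (contains_l1_of_independent b n c (e / 2) e); [lra|exact Hc| |exact Hb].
  intros m. destruct (HB m) as [M HM]. exists M. intros x [k ->]. auto.
Qed.

End Game.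

Lemma converges_0_of_upper_bounds b :
  (forall f r, 0 < r -> eventually (fun k => ev f (b k) < r)) ->
  converges (weak_open E) b (v0 E).
Proof.
  intros upper W Wopen W0. destruct (Wopen _ W0) as [L [r [Hr HW]]].
  apply filterS with (P := fun k => forall f, In f L -> Rabs (ev f (vsub (b k) (v0 E))) < r).
  - intros k. apply HW.
  - apply filter_forall_In. intros f _.
    apply filterS with (2 := filterI (upper f r Hr) (upper (dual_axpy (-2) f f) r Hr)).
    intros k [above below]. rewrite ev_axpy in below. rewrite ev_sub, ev_0. apply Rabs_def1; lra.
Qed.

Lemma ultrafilter_in_weak_closures (A : nat -> E -> Prop) :
  (forall i j x, (i <= j)%nat -> A j x -> A i x) ->
  (forall k W, weak_nbhd (v0 E) W -> exists x, A k x /\ W x) ->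
  exists U, UltraFilter U /\ (forall W, weak_nbhd (v0 E) W -> U W) /\ forall k, U (A k).
Proof.
  intros A_mono A_closure.
  set (F := fun S => exists k W, weak_nbhd (v0 E) W /\ forall x, A k x -> W x -> S x).
  assert (F_proper : ProperFilter F).
  { apply Build_ProperFilter_ex.
    - intros S [k [W [HW HS]]]. destruct (A_closure k W HW) as [x [Ax Wx]]. exists x. auto.
    - apply Build_Filter.
      + exists O, (fun _ => True). split; [apply filterT|]. intros x _ _. exact I.
      + intros S T [k [W [HW HS]]] [j [V [HV HT]]].
        exists (k + j)%nat, (fun x => W x /\ V x). split; [now apply filterI|].
        intros x Ax [Wx Vx].
        split; [apply HS|apply HT]; try assumption; apply A_mono with (2 := Ax); lia.
      + intros S T ST [k [W [HW HS]]]. exists k, W. auto. }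
  destruct (ultraFilterLemma F_proper) as [U [UU FU]]. exists U. split; [exact UU|]. split.
  - intros W HW. apply FU. exists O, W. auto.
  - intros k. apply FU. exists k, (fun _ => True). split; [apply filterT|auto].
Qed.

Lemma weakly_null_selection (A : nat -> E -> Prop) :
  ~ contains_l1 E -> E_bounded (A O) -> (forall i j x, (i <= j)%nat -> A j x -> A i x) ->
  (forall k W, weak_nbhd (v0 E) W -> exists x, A k x /\ W x) ->
  exists b, (forall k, A k (b k)) /\ converges (weak_open E) b (v0 E).
Proof.
  intros no_l1 HA A_mono A_closure.
  destruct (ultrafilter_in_weak_closures A A_mono A_closure) as [U [UU [U0 UA]]].
  assert (avoid : forall i, avoidable U (/ INR (S i)) (dual_ball i (INR i))).
  { intros i. apply (dual_ball_avoidable U UU U0 (A O)); auto; [apply pos_INR|].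
    apply Rinv_0_lt_compat, lt_0_INR. lia. }
  destruct (boolp.choice avoid) as [strat Hstrat].
  destruct (follows_exists (merge (fun p t x => A (length p) x /\ strat (length p) t x)))
    as [b Hb].
  { intros l. apply (filter_ex (F := U)), filter_merge; [typeclasses eauto|].
    intros p t. apply filterI; [apply UA|apply Hstrat]. }
  exists b. split.
  - intros k. pose proof (follows_merge _ b k Hb O) as [Ab _].
    now rewrite hist_length, Nat.add_0_r in Ab.
  - apply converges_0_of_upper_bounds. intros f r Hr.
    destruct (dual_ball_exhaust f) as [m Hm]. destruct (archimed_cor1 r Hr) as [j [Hj Hj0]].
    set (i := (m + j)%nat). apply (eventually_shift i).
    apply filterS with (P := fun k => ev f (b (i + k)%nat) < / INR (S i)).
    + intros k Hk. apply Rlt_trans with (1 := Hk), Rle_lt_trans with (2 := Hj).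
      apply Rinv_le_contravar; [apply lt_0_INR; lia|apply le_INR; lia].
    + apply (proj2 (Hstrat i) (fun k => b (i + k)%nat)).
      * intros k. pose proof (follows_merge _ b i Hb k) as [_ H]. now rewrite hist_length in H.
      * apply (dual_ball_mono m i (INR m)); [lia| |exact Hm].
        split; [apply pos_INR|apply le_INR; lia].
Qed.

(** * From sigma-locally finite k-networks to separability of the strong dual *)

(* If no finite union of members of the network inside [U] were a weak neighbourhood of
   [0] in [B], a weakly null sequence in [B] would escape all of these unions. *)
Lemma k_network_finite_weak_nbhd B N enum (U : E -> Prop) :
  ~ contains_l1 E -> E_bounded B -> k_network E (weak_open E) N ->
  locally_enumerated (weak_open E) N (v0 E) enum -> weak_open E U -> U (v0 E) ->
  exists l : list nat, (forall p, In p l -> forall x, enum p x -> U x) /\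
    weak_nbhd (v0 E) (fun x => B x -> exists p, In p l /\ enum p x).
Proof.
  intros no_l1 HB HN Henum HU U0. apply NNPP. intros Hno.
  set (A := fun i x => B x /\ U x /\
              ~ exists p, (p < i)%nat /\ (forall y, enum p y -> U y) /\ enum p x).
  destruct (weakly_null_selection A no_l1) as [b [Ab Hb]].
  - intros n. destruct (HB n) as [M HM]. exists M. intros x [Bx _]. auto.
  - intros i j x ij [Bx [Ux Hx]]. split; [exact Bx|]. split; [exact Ux|].
    intros [p [pi Hp]]. apply Hx. exists p. split; [lia|exact Hp].
  - intros i W HW. apply NNPP. intros HWA. apply Hno.
    destruct (bounded_comprehension (fun p => forall x, enum p x -> U x) i) as [l Hl].
    exists l. split; [intros p Hp; now apply Hl in Hp|].
    apply filterS with (2 := filterI HW (HU _ U0)). intros x [Wx Ux] Bx.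
    apply NNPP. intros Hx. apply HWA. exists x. split; [|exact Wx].
    split; [exact Bx|]. split; [exact Ux|]. intros [p [pi [pU px]]]. apply Hx.
    exists p. split; [now apply Hl|exact px].
  - destruct (k_network_catches_sequence N enum (v0 E) U b HN Henum HU U0
                (fun k => proj1 (proj2 (Ab k))) Hb) as [k [p Hp]].
    apply (Ab k). now exists p.
Qed.

Lemma weakly_aleph_countable_kernels B :
  ~ contains_l1 E -> weakly_aleph_space E -> E_bounded B ->
  exists G : nat -> list dual, forall f e, 0 < e ->
    exists n, forall x, B x -> (forall g, In g (G n) -> ev g x = 0) -> Rabs (ev f x) < e.
Proof.
  intros no_l1 [_ [N [HN Nfinite]]] HB.
  destruct (sigma_locally_finite_locally_enumerated N (v0 E) Nfinite) as [enum Henum].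
  destruct (countType_enumeration (list nat) nil) as [lists Hlists].
  destruct (choice_on nil
    (fun l => weak_nbhd (v0 E) (fun x => B x -> exists p : nat, In p l /\ enum p x))
    (fun l gs => forall x, (forall g, In g gs -> ev g x = 0) -> B x ->
                   exists p, In p l /\ enum p x)) as [G HG].
  { intros l [gs [r [Hr Hl]]]. exists gs. intros x Hx. apply Hl. intros g Hg.
    now rewrite ev_sub, ev_0, (Hx g Hg), Rminus_0_r, Rabs_R0. }
  exists (fun n => G (lists n)). intros f e He.
  destruct (k_network_finite_weak_nbhd B N enum (fun x => Rabs (ev f x - 0) < e))
    as [l [l_small Hl]]; auto.
  - apply weak_open_dist_lt.
  - now rewrite ev_0, Rminus_0_r, Rabs_R0.
  - destruct (Hlists l) as [n <-]. exists n. intros x Bx Hx.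
    destruct (HG _ Hl x Hx Bx) as [p [lp px]].
    rewrite <- (Rminus_0_r (ev f x)). now apply (l_small p).
Qed.

Definition abs_convex (B : E -> Prop) : Prop :=
  forall x y s t, Rabs s + Rabs t <= 1 -> B x -> B y -> B (s [*] x [+] t [*] y).

Lemma bounded_in_abs_convex B :
  E_bounded B -> exists D, E_bounded D /\ abs_convex D /\ forall x, B x -> D x.
Proof.
  intros HB. destruct (boolp.choice HB) as [M HM].
  exists (fun x => forall n, sem n x <= M n). split; [|split].
  - intros n. exists (M n). auto.
  - intros x y s t st Hx Hy n.
    apply Rle_trans with (1 := sem_triangle _ _ _ _). rewrite !sem_homog.
    specialize (Hx n). specialize (Hy n).
    pose proof (Rabs_pos s). pose proof (Rabs_pos t). pose proof (sem_ge0 n x). nra.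
  - intros x Bx n. auto.
Qed.

Lemma abs_convex_opp B x : abs_convex B -> B x -> B ((-1) [*] x).
Proof.
  intros HB Bx. rewrite <- (vadd0 E ((-1) [*] x)), <- (vscal_0l x). apply HB; auto.
  rewrite Rabs_m1, Rabs_R0. lra.
Qed.

Lemma abs_convex_slope_le B f g e x y :
  abs_convex B -> (forall z, B z -> ev g z = 0 -> Rabs (ev f z) <= e) ->
  B x -> B y -> 0 < ev g x -> 0 < ev g y ->
  (ev f x - e) / ev g x <= (ev f y + e) / ev g y.
Proof.
  intros HB Hker Bx By gx gy. set (w := ev g x + ev g y).
  assert (kernel : Rabs (ev f ((ev g y / w) [*] x [+] (- (ev g x / w)) [*] y)) <= e).
  { apply Hker.
    - apply HB; auto.
      rewrite Rabs_Ropp, !Rabs_pos_eq by (left; apply Rdiv_lt_0_compat; unfold w; lra).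
      right. unfold w. field. lra.
    - rewrite ev_add, !ev_scal. unfold w. field. lra. }
  rewrite ev_add, !ev_scal in kernel. apply (Rle_trans _ _ _ (Rle_abs _)) in kernel.
  apply Rmult_le_compat_r with (r := w) in kernel; [|unfold w; lra].
  replace ((ev g y / w * ev f x + - (ev g x / w) * ev f y) * w)
    with (ev f x * ev g y - ev f y * ev g x) in kernel by (unfold w; field; lra).
  apply Rmult_le_reg_r with (ev g x * ev g y); [now apply Rmult_lt_0_compat|].
  replace ((ev f x - e) / ev g x * (ev g x * ev g y))
    with ((ev f x - e) * ev g y) by (field; lra).
  replace ((ev f y + e) / ev g y * (ev g x * ev g y))
    with ((ev f y + e) * ev g x) by (field; lra).
  unfold w in kernel. lra.
Qed.

Lemma abs_convex_kernel_bound B f g e :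
  abs_convex B -> (forall x, B x -> ev g x = 0 -> Rabs (ev f x) <= e) ->
  exists c, close_on B e f (dual_axpy c dual_zero g).
Proof.
  intros HB Hker.
  assert (slope : exists c, forall x, B x -> 0 < ev g x -> Rabs (ev f x - c * ev g x) <= e).
  { destruct (classic (exists y, B y /\ 0 < ev g y)) as [[y [By gy]]|Hno].
    - destruct (separating_real
        (fun t => exists x, B x /\ 0 < ev g x /\ t = (ev f x - e) / ev g x)
        (fun t => exists x, B x /\ 0 < ev g x /\ t = (ev f x + e) / ev g x))
        as [c [lower upper]].
      + now exists ((ev f y - e) / ev g y), y.
      + now exists ((ev f y + e) / ev g y), y.
      + intros s t [x [Bx [gx ->]]] [z [Bz [gz ->]]]. now apply abs_convex_slope_le with B.
      + exists c. intros x Bx gx.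
        assert (le_c : (ev f x - e) / ev g x <= c) by (apply lower; now exists x).
        assert (c_le : c <= (ev f x + e) / ev g x) by (apply upper; now exists x).
        apply Rmult_le_compat_r with (r := ev g x) in le_c, c_le; try lra.
        unfold Rdiv in le_c, c_le. rewrite Rmult_assoc, Rinv_l, Rmult_1_r in le_c, c_le by lra.
        apply Rabs_le. lra.
    - exists 0. intros x Bx gx. destruct Hno. now exists x. }
  destruct slope as [c Hc]. exists c. intros x Bx. rewrite ev_axpy, ev_zero, Rplus_0_l.
  destruct (Rtotal_order (ev g x) 0) as [gx|[gx|gx]].
  - specialize (Hc _ (abs_convex_opp B x HB Bx)). rewrite !ev_scal in Hc.
    rewrite <- Rabs_Ropp.
    replace (- (ev f x - c * ev g x)) with (-1 * ev f x - c * (-1 * ev g x)) by ring.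
    apply Hc. lra.
  - rewrite gx, Rmult_0_r, Rminus_0_r. auto.
  - auto.
Qed.

Lemma finite_span_approx (gs : list dual) :
  exists s : nat -> dual, forall B f e d, E_bounded B -> abs_convex B -> 0 < d ->
    (forall x, B x -> (forall g, In g gs -> ev g x = 0) -> Rabs (ev f x) <= e) ->
    exists n, close_on B (e + d) f (s n).
Proof.
  destruct dense_sequence as [q Hq].
  destruct (countType_enumeration (nat * nat)%type (O, O)) as [idx Hidx].
  induction gs as [|g gs [s IH]].
  - exists (fun _ => dual_zero). intros B f e d _ _ Hd H. exists O. intros x Bx.
    rewrite ev_zero, Rminus_0_r. enough (Rabs (ev f x) <= e) by lra. apply H; [exact Bx|].
    intros g [].
  - exists (fun n => let (i, j) := idx n in dual_axpy (q i) (s j) g).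
    intros B f e d HB Bconvex Hd H.
    destruct (IH (fun x => B x /\ ev g x = 0) f e (d / 2)) as [j Hj]; [| |lra| |].
    + intros n. destruct (HB n) as [M HM]. exists M. intros x [Bx _]. auto.
    + intros x y a b ab [Bx gx] [By gy]. split; [now apply Bconvex|].
      rewrite ev_add, !ev_scal, gx, gy. ring.
    + intros x [Bx gx] Hx. apply H; [exact Bx|]. intros g' [<-|Hg']; auto.
    + destruct (abs_convex_kernel_bound B (dual_axpy (-1) f (s j)) g (e + d / 2) Bconvex)
        as [c Hc].
      { intros x Bx gx. rewrite ev_axpy. specialize (Hj x (conj Bx gx)).
        now replace (ev f x + -1 * ev (s j) x) with (ev f x - ev (s j) x) by ring. }
      destruct (dual_bounded_on B g HB) as [M [HM0 HM]].
      destruct (Hq c (d / (2 * (M + 1)))) as [i Hi]; [apply Rdiv_lt_0_compat; lra|].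
      destruct (Hidx (i, j)) as [n Hn]. exists n. rewrite Hn. intros x Bx.
      specialize (Hc x Bx). specialize (HM x Bx). rewrite !ev_axpy, ev_zero in *.
      assert (small : Rabs ((q i - c) * ev g x) <= d / 2).
      { rewrite Rabs_mult. replace (d / 2) with (d / (2 * (M + 1)) * (M + 1)) by (field; lra).
        apply Rmult_le_compat; try apply Rabs_pos; lra. }
      apply Rabs_le_between in Hc, small. apply Rabs_le. lra.
Qed.

Definition separable_on (B : E -> Prop) : Prop :=
  exists s : nat -> dual, forall f e, 0 < e -> exists n, close_on B e f (s n).

Lemma weakly_aleph_separable_on B :
  ~ contains_l1 E -> weakly_aleph_space E -> E_bounded B -> separable_on B.
Proof.
  intros no_l1 Haleph HB.
  destruct (bounded_in_abs_convex B HB) as [D [HD [Dconvex BD]]].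
  destruct (weakly_aleph_countable_kernels D no_l1 Haleph HD) as [G HG].
  destruct (boolp.choice (fun n => finite_span_approx (G n))) as [s Hs].
  destruct (countType_enumeration (nat * nat)%type (O, O)) as [idx Hidx].
  exists (fun n => let (i, j) := idx n in s i j). intros f e He.
  destruct (HG f (e / 2)) as [i Hi]; [lra|].
  destruct (Hs i D f (e / 2) (e / 2) HD Dconvex) as [j Hj]; [lra| |].
  - intros x Dx Hx. left. now apply Hi.
  - destruct (Hidx (i, j)) as [n Hn]. exists n. rewrite Hn. intros x Bx.
    replace e with (e / 2 + e / 2) by field. auto.
Qed.

Lemma strong_dual_separable_separable_on B :
  strong_dual_separable E -> E_bounded B -> separable_on B.
Proof.
  intros [s Hs] HB. exists s. intros f e He.
  destruct (Hs _ (strong_open_close_on_lt B f e HB)) as [n [d [de Hd]]].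
  - exists f, 0. split; [exact He|]. apply close_on_refl. lra.
  - exists n. apply close_on_sym, close_on_le with (2 := Hd). lra.
Qed.

(** * Countable networks in the strong dual under the density condition *)

Lemma density_condition_dual_ball n c :
  density_condition E -> 0 <= c ->
  exists (B : nat -> E -> Prop) (e : nat -> R),
    (forall k, E_bounded (B k) /\ 0 < e k) /\
    forall K eps, E_bounded K -> 0 < eps -> exists k, forall f g,
      dual_ball n c f -> dual_ball n c g -> close_on (B k) (e k) f g -> close_on K eps f g.
Proof.
  intros Hdensity Hc.
  assert (c2_ge0 : 0 <= c + c) by lra.
  assert (zero_ball : dual_ball n (c + c) dual_zero).
  { intros x. rewrite ev_zero, Rabs_R0. apply Rmult_le_pos; [exact c2_ge0|apply maxsem_ge0]. }
  destruct (metrizable_subset_first_countable _ dual_zero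
    (Hdensity _ (dual_ball_strong_bounded n (c + c) c2_ge0)) zero_ball) as [V [HV V_base]].
  assert (basic : forall k, exists Be : (E -> Prop) * R, E_bounded (fst Be) /\ 0 < snd Be /\
            forall h, close_on (fst Be) (snd Be) h dual_zero -> V k h).
  { intros k. destruct (HV k) as [Vopen V0]. destruct (Vopen _ V0) as [B [e [HB [He HBe]]]].
    now exists (B, e). }
  destruct (boolp.choice basic) as [Be HBe].
  exists (fun k => fst (Be k)), (fun k => snd (Be k)). split.
  { intros k. destruct (HBe k) as [HB [He _]]. now split. }
  intros K eps HK Heps.
  destruct (V_base _ (strong_open_close_on_lt K dual_zero eps HK)) as [k Hk].
  { exists 0. split; [exact Heps|]. apply close_on_refl. lra. }
  exists k. intros f g Bf Bg fg.
  assert (difference : forall A d,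
            close_on A d f g <-> close_on A d (dual_axpy (-1) f g) dual_zero).
  { intros A d. unfold close_on. split; intros H x Ax; specialize (H x Ax);
      rewrite ev_axpy, ev_zero in *;
      now replace (ev f x + -1 * ev g x - 0) with (ev f x - ev g x) in * by ring. }
  destruct (Hk (dual_axpy (-1) f g)) as [d [Hd close]].
  - intros x. rewrite ev_axpy. specialize (Bf x). specialize (Bg x).
    apply Rabs_le_between in Bf, Bg. apply Rabs_le. lra.
  - apply HBe. now apply difference.
  - apply difference, close_on_le with (2 := close). lra.
Qed.

Definition strong_network (W : nat -> dual -> Prop) : Prop :=
  forall f B eps, E_bounded B -> 0 < eps ->
    exists n, W n f /\ forall g, W n g -> close_on B eps g f.

Lemma strong_network_exists :
  density_condition E -> (forall B, E_bounded B -> separable_on B) ->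
  exists W, strong_network W.
Proof.
  intros Hdensity Hsep.
  destruct (boolp.choice (fun m => density_condition_dual_ball m (INR m) Hdensity (pos_INR m)))
    as [B HB].
  destruct (boolp.choice HB) as [e He].
  destruct (boolp.choice (fun mk : nat * nat =>
    Hsep (B (fst mk) (snd mk)) (proj1 (proj1 (He (fst mk)) (snd mk))))) as [s Hs].
  destruct (countType_enumeration (nat * nat * nat)%type (O, O, O)) as [idx Hidx].
  exists (fun n g => let '(m, k, j) := idx n in
    dual_ball m (INR m) g /\ close_on (B m k) (e m k / 2) g (s (m, k) j)).
  intros f K eps HK Heps. destruct (dual_ball_exhaust f) as [m Bf].
  destruct (proj2 (He m) K eps HK Heps) as [k Hk].
  pose proof (proj2 (proj1 (He m) k)) as e_pos.
  destruct (Hs (m, k) f (e m k / 2)) as [j Hj]; [lra|].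
  destruct (Hidx (m, k, j)) as [n Hn]. exists n. rewrite Hn. split; [now split|].
  intros g [Bg Hg]. apply Hk; [exact Bg|exact Bf|].
  replace (e m k) with (e m k / 2 + e m k / 2) by field.
  apply close_on_trans with (1 := Hg). now apply close_on_sym.
Qed.

Lemma strong_network_separable W : strong_network W -> strong_dual_separable E.
Proof.
  intros HW.
  destruct (choice_on dual_zero (fun n => exists g, W n g) W (fun n Hn => Hn)) as [s Hs].
  exists s. intros U HU [f Uf]. destruct (HU f Uf) as [B [eps [HB [Heps HUf]]]].
  destruct (HW f B eps HB Heps) as [n [Wf Hn]]. exists n. apply HUf, Hn, Hs. now exists f.
Qed.

Theorem weakly_aleph_strong_dual_separable :
  ~ contains_l1 E -> density_condition E -> weakly_aleph_space E -> strong_dual_separable E.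
Proof.
  intros no_l1 Hdensity Haleph.
  destruct (strong_network_exists Hdensity) as [W HW].
  - intros B. now apply weakly_aleph_separable_on.
  - now apply strong_network_separable with W.
Qed.

(** * From countable networks in the strong dual to countable k-networks *)

Lemma strong_network_slabs W :
  strong_network W ->
  exists M : nat -> E -> Prop, forall K f a r, E_bounded K -> 0 < r ->
    exists t, (forall x, K x -> Rabs (ev f x - a) < r / 2 -> M t x) /\
              (forall x, M t x -> Rabs (ev f x - a) < r).
Proof.
  intros HW. destruct dense_sequence as [q Hq].
  destruct (countType_enumeration (nat * nat * nat)%type (O, O, O)) as [idx Hidx].
  exists (fun t x => let '(n, i, j) := idx t in
            forall g, W n g -> Rabs (ev g x - q i) <= q j).
  intros K f a r HK Hr.
  destruct (HW f K (r / 8) HK) as [n [Wf Hn]]; [lra|].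
  destruct (Hq a (r / 8)) as [i Hi]; [lra|].
  destruct (Hq (13 / 16 * r) (r / 16)) as [j Hj]; [lra|].
  apply Rabs_def2 in Hi, Hj.
  destruct (Hidx (n, i, j)) as [t Ht]. exists t. rewrite Ht. split.
  - intros x Kx Hx g Wg. specialize (Hn g Wg x Kx).
    apply Rabs_le_between in Hn. apply Rabs_def2 in Hx. apply Rabs_le. lra.
  - intros x Hx. specialize (Hx f Wf). apply Rabs_le_between in Hx. apply Rabs_def1; lra.
Qed.

Theorem strong_network_weakly_aleph0 W : strong_network W -> weakly_aleph0_space E.
Proof.
  intros HW. split; [apply weak_regular|].
  destruct (strong_network_slabs W HW) as [M HM].
  destruct (countType_enumeration (list nat) nil) as [lists Hlists].
  set (net := fun n x => forall t, In t (lists n) -> M t x).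
  exists (fun S => exists n, net n = S). split; [|now exists net].
  apply k_network_of_local. intros K U x HK HU KU Kx.
  destruct (HU x (KU x Kx)) as [L [eps [Heps LU]]].
  destruct (list_choice (fun f t =>
      (forall y, K y -> Rabs (ev f y - ev f x) < eps / 2 -> M t y) /\
      (forall y, M t y -> Rabs (ev f y - ev f x) < eps)) L) as [l [Ll lL]].
  { intros f _. apply HM; [now apply weakly_compact_bounded|exact Heps]. }
  destruct (Hlists l) as [n Hn].
  exists (fun y => forall f, In f L -> Rabs (ev f y - ev f x) < eps / 2), (net n).
  unfold net. rewrite Hn. split; [|split; [|split; [|split]]].
  - apply weak_open_forall_In. intros f _. apply weak_open_dist_lt.
  - intros f _. rewrite Rminus_diag, Rabs_R0. lra.
  - exists n. now rewrite Hn.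
  - intros y Ky Hy t Ht. destruct (lL t Ht) as [f [Lf [slab _]]]. auto.
  - intros y Hy. apply LU. intros f Lf. destruct (Ll f Lf) as [t [lt [_ slab]]].
    rewrite ev_sub. auto.
Qed.

Theorem strong_dual_separable_weakly_aleph0 :
  density_condition E -> strong_dual_separable E -> weakly_aleph0_space E.
Proof.
  intros Hdensity Hsep.
  destruct (strong_network_exists Hdensity) as [W HW].
  - intros B. now apply strong_dual_separable_separable_on.
  - now apply strong_network_weakly_aleph0 with W.
Qed.

Lemma weakly_aleph0_weakly_aleph : weakly_aleph0_space E -> weakly_aleph_space E.
Proof. apply aleph0_space_aleph_space. intros x _. exact (filterT (F := weak_nbhd x)). Qed.

End FrechetSpace.

Theorem theorem5p7 (E : Frechet) :
  ~ contains_l1 E -> density_condition E ->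
  (weakly_aleph_space E <-> weakly_aleph0_space E) /\
  (weakly_aleph0_space E <-> strong_dual_separable E).
Proof.
  intros no_l1 Hdensity.
  pose proof (weakly_aleph0_weakly_aleph E).
  pose proof (weakly_aleph_strong_dual_separable E no_l1 Hdensity).
  pose proof (strong_dual_separable_weakly_aleph0 E Hdensity).
  tauto.
Qed.
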